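(* The Arvanitoyeorgos metric $g_A$ on $F(5)=\mathrm{SU}(5)/T^4$, i.e. (up to scaling) the $\mathrm{SU}(5)$-invariant Einstein metric with $x_{1k}=1$ for $k=2,\dots,5$ and $x_{ij}=\tfrac32$ for $2\le i<j\le5$, is $G$-non-degenerate and $G$-unstable, and its coindex is $3$.
   Context: $F(n)=\mathrm{SU}(n)/T^{n-1}$, where $T=T^{n-1}$ is the diagonal maximal torus with Lie algebra $\mathfrak{t}$; $G=\mathrm{SU}(n)$. Let $Q=-B$ be minus the Killing form of $\mathfrak{su}(n)$. There is a $Q$-orthogonal decomposition $\mathfrak{su}(n)=\mathfrak{t}\oplus\bigoplus_{1\le i<j\le n}\mathfrak{p}_{ij}$, where $\mathfrak{p}_{ij}$ is the 2-dimensional space of skew-Hermitian matrices whose only nonzero entries are in positions $(i,j)$ and $(j,i)$; the $\mathfrak{p}_{ij}$ are irreducible and pairwise inequivalent under $\mathrm{Ad}(T)$. Hence every $G$-invariant metric on $F(n)$ is determined by $g=\sum_{i<j}x_{ij}\,Q|_{\mathfrak{p}_{ij}}$ on $\mathfrak{p}=\bigoplus\mathfrak{p}_{ij}\cong T_oF(n)$ with $x_{ij}>0$, and is denoted by the tuple $(x_{ij})$ in lexicographic order. Stability notions. Let $\mathcal M_1^G$ be the manifold of unit-volume $G$-invariant metrics. A metric $g\in\mathcal M_1^G$ is Einstein ($\mathrm{Rc}(g)=\rho g$) iff it is a critical point of the scalar curvature functional $\mathrm{Sc}:\mathcal M_1^G\to\mathbb R$. Let $\mathrm{Sc}''_g$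 be the Hessian at such $g$, restricted to the space $\mathcal{TT}_g^G$ of $G$-invariant traceless divergence-free symmetric 2-tensors (here equal to $T_g\mathcal M_1^G$, the $G$-invariant $g$-traceless symmetric 2-tensors). The Einstein metric $g$ is $G$-unstable if $\mathrm{Sc}''_g(T,T)>0$ for some $T\in\mathcal{TT}_g^G$, and $G$-non-degenerate if $\mathrm{Sc}''_g|_{\mathcal{TT}_g^G}$ is non-degenerate; its coindex is the maximal dimension of a subspace of $\mathcal{TT}_g^G$ on which $\mathrm{Sc}''_g$ is positive definite. For Einstein metrics not of unit volume, these notions refer to the unit-volume rescaling. *)

(* Defs.v *)
(* Riemannian geometry of SU(n)-invariant metrics on F(n) = SU(n)/T, in terms
   of the reductive decomposition su(n) = t + p at the base point o, where p
   (skew-Hermitian matrices with zero diagonal) is identified with T_o F(n). *)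
From mathcomp Require Import all_boot all_order all_algebra.
From mathcomp Require Import all_classical all_reals all_analysis.
From mathcomp Require Import complex.

Set Implicit Arguments.
Unset Strict Implicit.
Unset Printing Implicit Defensive.

Import Order.TTheory GRing.Theory Num.Theory.
Import numFieldNormedType.Exports.

Local Open Scope classical_set_scope.
Local Open Scope ring_scope.

(* The pairs i < j indexing the summands p_ij. *)
Definition pairs (n : nat) := {p : 'I_n * 'I_n | (p.1 < p.2)%N}.

(* A tuple x = (x_ij) stands for the Ad(T)-invariant symmetric bilinear form
   \sum_(i < j) x_ij Q|p_ij on p; these are all the SU(n)-invariant symmetric
   2-tensors on F(n), see inv_form. *)
Notation inv_tensor R n := {ffun pairs n -> R^o}.

Section LieAlgebra.
Variables (R : realType) (n : nat).
Local Notation M := 'M[R[i]]_n.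
Implicit Types (X Y Z : M) (x T S : inv_tensor R n) (p : pairs n).

Definition bracket X Y : M := X *m Y - Y *m X.

(* trace of ad X \o ad Y, computed on gl_n(C) in the basis of matrix units. On
   su(n) this is the Killing form of su(n): gl_n(C) is the direct sum of the
   scalar matrices, killed by ad, and of the complexification of su(n). *)
Definition killing X Y : R[i] :=
  \sum_(a < n) \sum_(b < n) bracket X (bracket Y (delta_mx a b)) a b.

Definition Q X Y : R := - complex.Re (killing X Y).

Definition proj_t X : M := \matrix_(a, b) (if a == b then X a b else 0).

Definition proj_p X : M := \matrix_(a, b) (if a == b then 0 else X a b).

Definition proj_pair p X : M :=
  \matrix_(a, b)
    (if ((a, b) == sval p) || ((b, a) == sval p) then X a b else 0).

Definition in_p X : Prop :=
  (forall a, X a a = 0) /\ (forall a b, X b a = - ((X a b)^*)%C).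

(* The real basis of p consisting of E_ij - E_ji and i (E_ij + E_ji). It is
   orthogonal for every inv_form x. *)
Definition basis_p (k : pairs n * bool) : M :=
  let: (i, j) := sval k.1 in
  if k.2 then ('i)%C *: (delta_mx i j + delta_mx j i)
  else delta_mx i j - delta_mx j i.

Definition inv_form x X Y : R :=
  \sum_p x p * Q (proj_pair p X) (proj_pair p Y).

Definition inv_metric x : Prop := forall p, 0 < x p.

(* g-trace of a bilinear form on p, for g = inv_form x (basis_p is orthogonal
   for g). *)
Definition trace_g x (b : M -> M -> R) : R :=
  \sum_k b (basis_p k) (basis_p k) / inv_form x (basis_p k) (basis_p k).

(* Nomizu map of the Levi-Civita connection of g: Lam(X) Y is the element
   [X,Y]_p / 2 + U(X,Y) of p, where
   2 g(U(X,Y), Z) = g([Z,X]_p, Y) + g(X, [Z,Y]_p) for all Z in p. *)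
Definition nomizu x X Y : M :=
  \sum_k
    let e := basis_p k in
    (((inv_form x (proj_p (bracket X Y)) e
       + inv_form x (proj_p (bracket e X)) Y
       + inv_form x X (proj_p (bracket e Y))) / 2
      / inv_form x e e)%:C)%C *: e.

(* R(X,Y)Z at o, with the sign R(X,Y) = [D_X, D_Y] - D_[X,Y]. *)
Definition curvature x X Y Z : M :=
  nomizu x X (nomizu x Y Z) - nomizu x Y (nomizu x X Z)
  - nomizu x (proj_p (bracket X Y)) Z
  - bracket (proj_t (bracket X Y)) Z.

Definition Rc x X Y : R :=
  trace_g x (fun Z W => inv_form x (curvature x Z X Y) W).

Definition Sc x : R := trace_g x (Rc x).

Definition einstein x : Prop :=
  inv_metric x /\
  exists rho : R, forall X Y, in_p X -> in_p Y ->
    Rc x X Y = rho * inv_form x X Y.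

(* v is the volume of F(n) for the metric Q|p; the density of g with respect
   to it is the square root of the determinant of g relative to Q. *)
Definition volume (v : R) x : R :=
  v * Num.sqrt (\prod_k (inv_form x (basis_p k) (basis_p k)
                         / Q (basis_p k) (basis_p k))).

Definition M1 (v : R) x : Prop := inv_metric x /\ volume v x = 1.

(* Invariant g-traceless tensors; invariant tensors on F(n) are
   divergence-free. *)
Definition TT x T : Prop := trace_g x (inv_form T) = 0.

(* Hessian of Sc on M1 at a critical point g: the symmetric bilinear form whose
   value on (T, T) is (Sc \o c)''(0) for all curves c in M1 with c(0) = g and
   c'(0) = T. Only its values on TT g are determined. *)
Definition is_hessian (v : R) x (H : inv_tensor R n -> inv_tensor R n -> R) :
    Prop :=
  [/\ forall T S, H T S = H S T,
      forall (a : R) T1 T2 S, H (a *: T1 + T2) S = a * H T1 S + H T2 S &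
      forall T (c : R -> inv_tensor R n), TT x T ->
        (forall t, M1 v (c t)) ->
        (forall p t, derivable (fun s => c s p : R) t 1 /\
                     derivable (derive1 (fun s => c s p : R)) t 1) ->
        c 0 = x ->
        (forall p, derive1 (fun s => c s p : R) 0 = T p) ->
        derive1n 2 (fun t => Sc (c t)) 0 = H T T].

(* For an Einstein metric x of any volume: g is the unit-volume rescaling of x
   and H is the Hessian at g. *)
Definition stability_data (v : R) x (g : inv_tensor R n)
    (H : inv_tensor R n -> inv_tensor R n -> R) : Prop :=
  [/\ exists2 a : R, 0 < a & g = a *: x, M1 v g, einstein g & is_hessian v g H].

Definition G_unstable (v : R) x : Prop :=
  exists g H, stability_data v x g H /\ exists2 T, TT g T & 0 < H T T.

Definition G_nondegenerate (v : R) x : Prop :=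
  exists g H, stability_data v x g H /\
    forall T, TT g T -> (forall S, TT g S -> H T S = 0) -> T = 0.

Definition positive_subspace (g : inv_tensor R n)
    (H : inv_tensor R n -> inv_tensor R n -> R)
    (U : {vspace inv_tensor R n}) : Prop :=
  forall T, T \in U -> TT g T /\ (T != 0 -> 0 < H T T).

Definition has_coindex (v : R) x (m : nat) : Prop :=
  exists g H, [/\ stability_data v x g H,
    exists2 U, positive_subspace g H U & \dim U = m &
    forall U, positive_subspace g H U -> (\dim U <= m)%N].

End LieAlgebra.

(* The index 1 of the usual numbering is the element 0 of 'I_5. *)
Definition gA (R : realType) : inv_tensor R 5 :=
  [ffun p : pairs 5 => if val (sval p).1 == 0%N then 1 else 3 / 2].

(* Main.v *)
(** On su(n), the Nomizu map of an invariant metric (x_ab) is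
      (Lam(X) Y)_ab = \sum_c (A_acb X_ac Y_cb - A_bca Y_ac X_cb)  for a != b,
    with A_acb = (x_ab + x_cb - x_ac) / (2 x_ab). It is complex bilinear, so the
    trace defining Rc can be taken over the matrix units E_ab, a != b, of the
    complexification of p; it gives a diagonal Ricci tensor and
      Sc = \sum_(a != b) 1/(2 x_ab)
           - 1/(4n) \sum_(a, b, c distinct) x_ab / (x_ac x_bc).
    In the coordinates u = ln x this is a sum of exponentials of linear forms
    w_m(u). The gradient of Sc at an Einstein metric is a multiple of the gradient
    of the logarithm of the volume, so the second derivatives of u along a
    unit-volume curve do not contribute, and the Hessian is
    \sum_m (m-th monomial) * w_m(tau)^2 with tau_ab = T_ab / x_ab.

    For g_A write tau = (s, t), with s_j = tau_1j and t_ij = tau_ij for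
    2 <= i < j, so that TT is the hyperplane \sum s + \sum t = 0. As a
    representation of the symmetric group of {2, ..., 5}, this hyperplane is a
    trivial line, two copies of the standard representation (one in s, one in t)
    and a plane in t. Let J change the sign of everything except the standard
    component of s. Then H(tau, J tau) is a positive definite sum of squares on
    TT. So H is non-degenerate, positive on the 3-dimensional space where
    t = 0 and \sum s = 0, and non-positive on the tau in TT with constant s. *)
Require Import Defs.
From HB Require Import structures.
From mathcomp Require Import all_boot all_order all_algebra.
From mathcomp Require Import all_classical all_reals all_analysis.
From mathcomp Require Import complex zify ring lra.

Set Implicit Arguments.
Unset Strict Implicit.
Unset Printing Implicit Defensive.

Import Order.TTheory GRing.Theory Num.Theory.
Import numFieldNormedType.Exports.

Local Open Scope ring_scope.

(** * Sums over pairs and triples of distinct indices *)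

Section Sums.
Variable n : nat.

Lemma sum_pairs (V : nmodType) (F : 'I_n -> 'I_n -> V) :
  \sum_(p : pairs n) (F (sval p).1 (sval p).2 + F (sval p).2 (sval p).1) =
  \sum_a \sum_(b | b != a) F a b.
Proof.
rewrite big_split /= -(big_sub (fun p : 'I_n * 'I_n => p.1 < p.2)%N
  (fun p => F p.1 p.2)) -(big_sub (fun p : 'I_n * 'I_n => p.1 < p.2)%N
  (fun p => F p.2 p.1)) /=.
rewrite -(pair_big_dep xpredT (fun a b : 'I_n => a < b)%N (fun a b => F a b)).
rewrite -(pair_big_dep xpredT (fun a b : 'I_n => a < b)%N (fun a b => F b a)).
rewrite [X in _ + X](exchange_big_dep xpredT) //= -big_split /=.
apply: eq_bigr => a _; rewrite [RHS](bigID (fun b : 'I_n => a < b)%N) /=.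
congr (_ + _); apply: eq_bigl => b; rewrite -val_eqE /=; lia.
Qed.

(* Extension of a tuple (x_ij), i < j, to all ordered pairs of indices, with
   value 0 on the diagonal. *)
Definition sym (R : pzRingType) (x : {ffun pairs n -> R}) (a b : 'I_n) : R :=
  \sum_(p | (sval p == (a, b)) || (sval p == (b, a))) x p.

Lemma symC (R : pzRingType) (x : {ffun pairs n -> R}) a b :
  sym x a b = sym x b a.
Proof. by apply: eq_bigl => p; rewrite orbC. Qed.

Lemma sym_pair (R : pzRingType) (x : {ffun pairs n -> R}) p :
  sym x (sval p).1 (sval p).2 = x p.
Proof.
rewrite /sym (big_pred1 p) // => q; rewrite -[RHS]/(val q == val p).
case: p q => [[a b] /= ab] [[c d] /= cd]; rewrite !xpair_eqE -!val_eqE /=; lia.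
Qed.

Lemma sym_diag (R : pzRingType) (x : {ffun pairs n -> R}) a : sym x a a = 0.
Proof.
by rewrite /sym big_pred0 // => -[[c d] /= cd]; rewrite !xpair_eqE -!val_eqE /=; lia.
Qed.

Lemma symZ (R : pzRingType) (k : R) (x : {ffun pairs n -> R^o}) a b :
  sym (k *: x : {ffun pairs n -> R^o}) a b = k * sym x a b.
Proof. by rewrite /sym mulr_sumr; apply: eq_bigr => p _; rewrite ffunE. Qed.

Lemma pairP (a b : 'I_n) : a != b ->
  {p : pairs n | sval p = (a, b) \/ sval p = (b, a)}.
Proof.
rewrite -val_eqE /= => ab; case: (ltnP a b) => [lt_ab|le_ba].
  by exists (exist _ (a, b) lt_ab); left.
have lt_ba : (b < a)%N by lia.
by exists (exist _ (b, a) lt_ba); right.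
Qed.

Lemma sym_gt0 (R : numDomainType) (x : {ffun pairs n -> R}) a b :
  (forall p, 0 < x p) -> a != b -> 0 < sym x a b.
Proof.
move=> x_gt0 /pairP[p [] e]; [|rewrite symC]; have := x_gt0 p;
  by rewrite -sym_pair e.
Qed.

Lemma sum_pairs_sym (V : nmodType) (F : 'I_n -> 'I_n -> V) :
  (forall a b, F a b = F b a) ->
  \sum_a \sum_(b | b != a) F a b =
  (\sum_(p : pairs n) F (sval p).1 (sval p).2) *+ 2.
Proof.
move=> FC; rewrite -sum_pairs -sumrMnl; apply: eq_bigr => p _.
by rewrite [X in _ + X]FC mulr2n.
Qed.

Definition sum_triples (V : nmodType) (F : 'I_n -> 'I_n -> 'I_n -> V) : V :=
  \sum_a \sum_(b | b != a) \sum_(c | (c != a) && (c != b)) F a b c.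

(** With the distinctness conditions moved into the summand the three ranges are independent.
    Permuting indices is then [exchange_big], and the sum can be expanded for a concrete [n]. *)
Lemma sum_triplesE (V : nmodType) (F : 'I_n -> 'I_n -> 'I_n -> V) :
  sum_triples F = \sum_a \sum_b \sum_c if [&& b != a, c != a & c != b] then F a b c else 0.
Proof.
apply: eq_bigr => a _; rewrite big_mkcond; apply: eq_bigr => b _.
case: ifP => _ /=; last by rewrite big1.
by rewrite big_mkcond.
Qed.

Lemma sum_triples_swap12 (V : nmodType) (F : 'I_n -> 'I_n -> 'I_n -> V) :
  sum_triples F = sum_triples (fun a b c => F b a c).
Proof.
rewrite !sum_triplesE exchange_big /=; do 3 apply: eq_bigr => ? _.
by rewrite eq_sym [(_ != _) && (_ != _)]andbC.
Qed.

Lemma sum_triples_swap23 (V : nmodType) (F : 'I_n -> 'I_n -> 'I_n -> V) :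
  sum_triples F = sum_triples (fun a b c => F a c b).
Proof.
rewrite !sum_triplesE; apply: eq_bigr => a _; rewrite exchange_big /=.
by do 2 apply: eq_bigr => ? _; rewrite andbCA [in X in [&& _, _ & X]]eq_sym.
Qed.

Lemma sum_triplesD (V : nmodType) (F G : 'I_n -> 'I_n -> 'I_n -> V) :
  sum_triples (fun a b c => F a b c + G a b c) = sum_triples F + sum_triples G.
Proof.
rewrite /sum_triples -big_split; apply: eq_bigr => a _; rewrite -big_split.
by apply: eq_bigr => b _; rewrite -big_split.
Qed.

Lemma sum_triplesN (V : zmodType) (F : 'I_n -> 'I_n -> 'I_n -> V) :
  sum_triples (fun a b c => - F a b c) = - sum_triples F.
Proof.
rewrite /sum_triples -sumrN; apply: eq_bigr => a _; rewrite -sumrN.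
by apply: eq_bigr => b _; rewrite -sumrN.
Qed.

Lemma sum_triples_mulr (V : pzRingType) (k : V) (F : 'I_n -> 'I_n -> 'I_n -> V) :
  sum_triples (fun a b c => k * F a b c) = k * sum_triples F.
Proof.
rewrite /sum_triples mulr_sumr; apply: eq_bigr => a _; rewrite mulr_sumr.
by apply: eq_bigr => b _; rewrite mulr_sumr.
Qed.

Lemma eq_sum_triples (V : nmodType) (F G : 'I_n -> 'I_n -> 'I_n -> V) :
  (forall a b c, b != a -> c != a -> c != b -> F a b c = G a b c) ->
  sum_triples F = sum_triples G.
Proof.
move=> FG; apply: eq_bigr => a _; apply: eq_bigr => b ba.
by apply: eq_bigr => c /andP[]; apply: FG.
Qed.

End Sums.

(** * The Nomizu map and the curvature *)

Section Nomizu.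
Variables (R : realType) (n : nat).
Local Notation C := R[i].
Local Notation M := 'M[C]_n.
Implicit Types (X Y Z : M) (x T S : inv_tensor R n) (p : pairs n).

Lemma mul_delta_mx_l (a b c d : 'I_n) Y :
  (delta_mx a b *m Y) c d = if c == a then Y b d else 0.
Proof.
rewrite mxE (bigD1 b) //= !mxE eqxx andbT big1 ?addr0 => [|e eb].
  by case: eqP; rewrite ?mul1r ?mul0r.
by rewrite mxE (negPf eb) andbF mul0r.
Qed.

Lemma mul_delta_mx_r (a b c d : 'I_n) Y :
  (Y *m delta_mx a b) c d = if d == b then Y c a else 0.
Proof.
rewrite mxE (bigD1 a) //= !mxE eqxx big1 ?addr0 => [|e ea].
  by case: eqP; rewrite ?mulr1 ?mulr0.
by rewrite mxE (negPf ea) mulr0.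
Qed.

(** By [ent], the E_ab coefficient of ad X (ad Y E_ab) is (XY)_aa - X_aa Y_bb - Y_aa X_bb + (YX)_bb.
    In the sum over a and b the outer terms are each repeated n times and the mixed ones factor into
    traces. *)
Lemma killingE X Y :
  killing X Y = (n%:R * \tr (X *m Y) - \tr X * \tr Y) *+ 2.
Proof.
rewrite /killing.
have ent a b : bracket X (bracket Y (delta_mx a b)) a b =
    (X *m Y) a a - X a a * Y b b - (Y a a * X b b - (Y *m X) b b).
  have mid (A B : M) : (A *m delta_mx a b *m B) a b = A a a * B b b.
    rewrite mxE (bigD1 b) //= mul_delta_mx_r eqxx big1 ?addr0 // => d db.
    by rewrite mul_delta_mx_r (negPf db) mul0r.
  have subE (A B : M) : (A - B) a b = A a b - B a b by rewrite !mxE.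
  rewrite /bracket mulmxBr mulmxBl !subE mulmxA -[delta_mx a b *m Y *m X]mulmxA.
  by rewrite mul_delta_mx_r eqxx mul_delta_mx_l eqxx mulmxA !mid.
under eq_bigr => a _ do under eq_bigr => b _ do rewrite ent.
under eq_bigr => a _ do
  rewrite !sumrB !sumr_const card_ord -!mulr_sumr -/(mxtrace X) -/(mxtrace Y)
    -/(mxtrace (Y *m X)).
rewrite !sumrB !sumrMnl -!mulr_suml sumr_const card_ord -!/(mxtrace _).
by rewrite (mxtrace_mulC Y X); ring.
Qed.

(** Complex bilinear form whose real part, times -2n, is [inv_form x] ([inv_formE]). It turns
    statements about the metric into trace identities. *)
Definition gsum x X Y : C := \sum_a \sum_b (sym x a b)%:C%C * (X a b * Y b a).

Lemma tr_proj_pair p X Y :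
  \tr (proj_pair p X *m proj_pair p Y) =
  X (sval p).1 (sval p).2 * Y (sval p).2 (sval p).1 +
  X (sval p).2 (sval p).1 * Y (sval p).1 (sval p).2.
Proof.
pose F a b : C := proj_pair p X a b * proj_pair p Y b a.
have -> : \tr (proj_pair p X *m proj_pair p Y) = \sum_a \sum_(b | b != a) F a b.
  apply: eq_bigr => a _; rewrite mxE (bigD1 a) //= !mxE.
  case: ifP => [|_]; last by rewrite mul0r add0r.
  by case: p @F => -[c d] /= cd; rewrite !xpair_eqE -!val_eqE /=; lia.
rewrite -sum_pairs (bigD1 p) //= big1 ?addr0 => [|q].
  by rewrite /F !mxE /= -surjective_pairing eqxx orbT /=.
rewrite -val_eqE /F !mxE; case: p q {F} => [[a b] /= ab] [[c d] /= cd].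
rewrite !xpair_eqE -!val_eqE /= => pq.
do 2 (case: ifP => [|_]; first by lia).
by rewrite !mul0r addr0.
Qed.

Lemma proj_pair_trace p X : \tr (proj_pair p X) = 0.
Proof.
rewrite /mxtrace big1 // => a _; rewrite mxE; case: ifP => //.
by case: p => -[c d] /= cd; rewrite !xpair_eqE -!val_eqE /=; lia.
Qed.

Lemma conjcB (z w : C) : conjc (z - w) = conjc z - conjc w.
Proof. exact: rmorphB. Qed.

Lemma conjc_sum (I : Type) (s : seq I) (P : pred I) (F : I -> C) :
  conjc (\sum_(i <- s | P i) F i) = \sum_(i <- s | P i) conjc (F i).
Proof. exact: rmorph_sum. Qed.

Lemma conjcM (z w : C) : conjc (z * w) = conjc z * conjc w.
Proof. exact: rmorphM. Qed.

Lemma ReD (z w : C) : complex.Re (z + w) = complex.Re z + complex.Re w.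
Proof. by case: z w => ? ? []. Qed.

Lemma ReZ (r : R) (z : C) : complex.Re (r%:C%C * z) = r * complex.Re z.
Proof. by case: z => a b /=; rewrite mul0r subr0. Qed.

Lemma Re_sum (I : Type) (s : seq I) (P : pred I) (F : I -> C) :
  complex.Re (\sum_(i <- s | P i) F i) = \sum_(i <- s | P i) complex.Re (F i).
Proof. exact: (big_morph _ ReD). Qed.

Lemma gsumE x X Y : gsum x X Y =
  \sum_p (x p)%:C%C * (X (sval p).1 (sval p).2 * Y (sval p).2 (sval p).1 +
                       X (sval p).2 (sval p).1 * Y (sval p).1 (sval p).2).
Proof.
transitivity (\sum_a \sum_(b | b != a) (sym x a b)%:C%C * (X a b * Y b a)).
  by apply: eq_bigr => a _; rewrite (bigD1 a) //= sym_diag mul0r add0r.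
by rewrite -sum_pairs; apply: eq_bigr => p _; rewrite [sym x _.2 _]symC sym_pair mulrDr.
Qed.

Lemma inv_formE x X Y : inv_form x X Y = - (complex.Re (gsum x X Y) *+ n *+ 2).
Proof.
rewrite gsumE Re_sum -!sumrMnl -sumrN; apply: eq_bigr => p _.
rewrite /Q killingE !proj_pair_trace mul0r subr0 tr_proj_pair ReZ.
set z := (_ + _); rewrite !mulr2n ReD mulr_natl.
by rewrite -[z *+ n]mulr_natl -(rmorph_nat (real_complex R)) ReZ -mulr_natl; ring.
Qed.

Lemma basis_p_delta p (r : bool) : basis_p R (p, r) =
  if r then ('i)%C *: (delta_mx (sval p).1 (sval p).2 + delta_mx (sval p).2 (sval p).1)
  else delta_mx (sval p).1 (sval p).2 - delta_mx (sval p).2 (sval p).1.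
Proof. by case: p => -[]. Qed.

Lemma basis_pE p (r : bool) a b : basis_p R (p, r) a b =
  if (a, b) == sval p then (if r then 'i%C else 1 : C)
  else if (b, a) == sval p then (if r then 'i%C else - 1 : C) else 0.
Proof.
case: p => -[c d] /= cd; rewrite /basis_p /= !xpair_eqE -!val_eqE /=.
case: r; rewrite !mxE -!val_eqE /=.
  by case: eqP => ?; case: eqP => ?; case: eqP => ?; case: eqP => ?;
    rewrite /= ?addr0 ?add0r ?mulr0 ?mulr1 //; lia.
by case: eqP => ?; case: eqP => ?; case: eqP => ?; case: eqP => ?;
  rewrite /= ?subr0 ?sub0r ?oppr0 //; lia.
Qed.

Lemma basis_p_neq p r q : q != p ->
  basis_p R (p, r) (sval q).1 (sval q).2 = 0 /\
  basis_p R (p, r) (sval q).2 (sval q).1 = 0.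
Proof.
rewrite -val_eqE !basis_pE; case: p q => [[a b] /= ab] [[c d] /= cd].
rewrite !xpair_eqE -!val_eqE /= => pq.
by split; do 2 (case: ifP => ?; first by lia).
Qed.

Lemma basis_p_eq p r :
  basis_p R (p, r) (sval p).1 (sval p).2 = (if r then 'i%C else 1 : C) /\
  basis_p R (p, r) (sval p).2 (sval p).1 = (if r then 'i%C else - 1 : C).
Proof.
rewrite !basis_pE -surjective_pairing eqxx; split=> //.
by case: p => -[a b] /= ab; rewrite xpair_eqE -!val_eqE; case: ifP => /= ?; [lia|].
Qed.

Lemma basis_in_p (k : pairs n * bool) : in_p (basis_p R k).
Proof.
case: k => p r; split=> [a|a b]; rewrite !basis_pE.
  by case: p => -[c d] /= cd; rewrite !xpair_eqE -!val_eqE /=; do 2 (case: ifP => ?; first lia).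
case: p => -[c d] /= cd; rewrite !xpair_eqE -!val_eqE /=.
case: r; repeat (case: ifP => ?; try lia);
  by apply/eqP; rewrite eq_complex /= ?oppr0 ?opprK !eqxx.
Qed.

(* Keeps unification from comparing values of inv_form by unfolding killing. *)
#[local] Opaque inv_form basis_p.

Lemma inv_form_basis x X p r : inv_form x X (basis_p R (p, r)) =
  (if r then complex.Im (X (sval p).1 (sval p).2) + complex.Im (X (sval p).2 (sval p).1)
   else complex.Re (X (sval p).1 (sval p).2) - complex.Re (X (sval p).2 (sval p).1))
  * x p *+ n *+ 2.
Proof.
rewrite inv_formE gsumE (bigD1 p) //= big1 ?addr0 => [|q qp]; last first.
  by have [-> ->] := basis_p_neq r qp; rewrite !mulr0 addr0 mulr0.
have [-> ->] := basis_p_eq p r; rewrite ReZ ReD.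
case: r; case: (X _ _) => a b; case: (X _ _) => c d /=;
 by rewrite -!mulNrn; congr (_ *+ _ *+ _); ring.
Qed.

Lemma pair_n_gt0 p : (0 < n)%N.
Proof. by case: p => -[[a an] b] _; apply: leq_ltn_trans an. Qed.

Lemma inv_form_basis_basis x p r :
  inv_form x (basis_p R (p, r)) (basis_p R (p, r)) = x p *+ n *+ 4.
Proof.
rewrite inv_form_basis; have [-> ->] := basis_p_eq p r.
case: r => /=; rewrite ?opprK -(natrD _ 1 1) mulr_natl;
  rewrite -!mulrnA; congr (_ *+ _); lia.
Qed.

(** The weight [x p] and the factor n cancel, so the coordinates do not depend on the metric. [X] is
    an arbitrary matrix, as [trace_linear] requires. *)
Lemma inv_form_basis_ratio x p r X : x p != 0 ->
  inv_form x X (basis_p R (p, r)) / inv_form x (basis_p R (p, r)) (basis_p R (p, r)) =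
  (if r then complex.Im (X (sval p).1 (sval p).2) + complex.Im (X (sval p).2 (sval p).1)
   else complex.Re (X (sval p).1 (sval p).2) - complex.Re (X (sval p).2 (sval p).1)) / 2.
Proof.
move=> xp; rewrite inv_form_basis_basis inv_form_basis.
set u := (if r then _ else _).
have n0 : n%:R != 0 :> R by rewrite pnatr_eq0 -lt0n (pair_n_gt0 p).
rewrite -[_ *+ n *+ 2]mulr_natr -[_ *+ n *+ 4]mulr_natr -2![_ *+ n]mulr_natr.
by field; rewrite n0 xp.
Qed.

Lemma basis_expansion x X : inv_metric x -> in_p X ->
  \sum_k (inv_form x X (basis_p R k) / inv_form x (basis_p R k) (basis_p R k))%:C%C
    *: basis_p R k = X.
Proof.
move=> x_gt0 [X0 XJ].
have xN0 p : x p != 0 by rewrite gt_eqF.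
apply/matrixP => a b; rewrite summxE.
pose f p (r : bool) := (if r
   then complex.Im (X (sval p).1 (sval p).2) + complex.Im (X (sval p).2 (sval p).1)
   else complex.Re (X (sval p).1 (sval p).2) - complex.Re (X (sval p).2 (sval p).1)) / 2.
transitivity (\sum_p \sum_r (f p r)%:C%C * basis_p R (p, r) a b).
  rewrite (pair_bigA _ (fun p r => (f p r)%:C%C * basis_p R (p, r) a b)) /=.
  apply: eq_bigr => -[p r] _; rewrite mxE; congr (_%:C%C * _).
  exact: inv_form_basis_ratio.
have [<-|ab] := eqVneq a b.
  rewrite X0 big1 // => p _; rewrite big1 // => r _.
  by rewrite (basis_in_p _).1 mulr0.
have [p ep] := pairP ab; rewrite (bigD1 p) //= [X in _ + X]big1 => [|q qp]; last first.
  rewrite big1 // => r _; rewrite eq_sym in qp; have := basis_p_neq r qp.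
  by case: ep => -> /= [e1 e2]; rewrite ?e1 ?e2 mulr0.
rewrite addr0 big_bool /f.
have := basis_p_eq p true; have := basis_p_eq p false.
case: ep => -> [/= e1 e2] [/= e3 e4]; rewrite ?(e1, e2, e3, e4) (XJ a b).
  move: (X a b) => [u v] /=.
  apply/eqP; rewrite eq_complex /=; simpc; apply/andP; split; apply/eqP; lra.
move: (X a b) => [u v] /=.
apply/eqP; rewrite eq_complex /=; simpc; apply/andP; split; apply/eqP; lra.
Qed.

(* The trace over the real basis of p is the trace over the complexification of p,
   in the basis of matrix units. *)
Lemma trace_linear x (L : M -> M) : inv_metric x ->
  (forall X Y, L (X + Y) = L X + L Y) -> (forall a X, L (a *: X) = a *: L X) ->
  trace_g x (fun Z W => inv_form x (L Z) W) =
  complex.Re (\sum_a \sum_(b | b != a) L (delta_mx a b) a b).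
Proof.
move=> x_gt0 LD LZ.
have xN0 p : x p != 0 by rewrite gt_eqF.
rewrite -sum_pairs Re_sum.
transitivity (\sum_p \sum_(r : bool) (if r
   then complex.Im (L (basis_p R (p, r)) (sval p).1 (sval p).2) +
        complex.Im (L (basis_p R (p, r)) (sval p).2 (sval p).1)
   else complex.Re (L (basis_p R (p, r)) (sval p).1 (sval p).2) -
        complex.Re (L (basis_p R (p, r)) (sval p).2 (sval p).1)) / 2).
  rewrite pair_bigA; apply: eq_bigr => -[p r] _; exact: inv_form_basis_ratio.
apply: eq_bigr => p _; rewrite big_bool.
(* Since Im(iz) = Re z, the two basis vectors of p_ij give the same diagonal terms and opposite
   cross terms, which cancel. *)
rewrite !basis_p_delta LZ -scaleN1r !LD LZ !mxE.
set L12 := L (delta_mx (sval p).1 _); set L21 := L (delta_mx (sval p).2 _).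
move: (L12 _ _) (L12 _ _) (L21 _ _) (L21 _ _) => [? ?] [? ?] [? ?] [? ?] /=.
by field.
Qed.

(** The operator representing the metric with respect to the trace form ([gsum_trl]). Its zero
    weights on the diagonal also absorb the projection to p. *)
Definition hadamard x X : M := \matrix_(a, b) ((sym x a b)%:C%C * X a b).

Lemma gsum_trl x X Y : gsum x X Y = \tr (hadamard x X *m Y).
Proof.
apply: eq_bigr => a _; rewrite mxE; apply: eq_bigr => b _.
by rewrite mxE mulrA.
Qed.

Lemma gsumC x X Y : gsum x X Y = gsum x Y X.
Proof.
rewrite /gsum exchange_big; apply: eq_bigr => a _; apply: eq_bigr => b _.
by rewrite symC [X _ _ * _]mulrC.
Qed.

Lemma gsum_proj_p x X Y : gsum x (proj_p X) Y = gsum x X Y.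
Proof.
apply: eq_bigr => a _; apply: eq_bigr => b _; rewrite mxE.
by case: eqP => // ->; rewrite sym_diag !mul0r.
Qed.

Definition nomizu_coef x a c b : C :=
  ((sym x a b + sym x c b - sym x a c) / (2 * sym x a b))%:C%C.

(* The formula for nomizu on p (nomizuE), taken as a definition on all matrices,
   where it is complex bilinear, unlike nomizu. *)
Definition nomizuC x X Y : M := \matrix_(a, b) (if a == b then 0 else
  \sum_c (nomizu_coef x a c b * (X a c * Y c b) - nomizu_coef x b c a * (Y a c * X c b))).

(** The Koszul formula with the test vector removed: pairing both sides with a basis vector under
    the trace gives the formula that defines [nomizu]. *)
Lemma hadamard_nomizuC x X Y : inv_metric x ->
  hadamard x (nomizuC x X Y) *+ 2 =
  hadamard x (bracket X Y) + bracket X (hadamard x Y) + bracket Y (hadamard x X).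
Proof.
move=> x_gt0; apply/matrixP => a b.
rewrite mulr2n /bracket !mxE -!sumrB mulr_sumr -!big_split /=.
(* On the diagonal the weight is 0, and the last two brackets cancel because [sym] is symmetric. *)
have [->|ab] := eqVneq a b.
  rewrite mulr0 addr0 big1 // => c _.
  by rewrite !mxE sym_diag [sym x c b]symC; ring.
have xab : (sym x a b)%:C%C != 0 :> C.
  by rewrite (inj_eq (@complexI _)) gt_eqF ?sym_gt0.
rewrite mulr_sumr -big_split /=; apply: eq_bigr => c _.
rewrite !mxE /nomizu_coef [sym x b a]symC [sym x c a]symC [sym x b c]symC.
rewrite !(fmorph_div, rmorphM, rmorphD, rmorphB, rmorph1, rmorph_nat) /=.
by field; rewrite xab.
Qed.

Lemma nomizuC_in_p x X Y : in_p X -> in_p Y -> in_p (nomizuC x X Y).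
Proof.
move=> [_ XJ] [_ YJ]; split=> [a|a b]; first by rewrite mxE eqxx.
rewrite !mxE eq_sym; case: ifP => _; first by rewrite conjc0 oppr0.
rewrite conjc_sum -sumrN; apply: eq_bigr => c _.
have coefJ d e f : conjc (nomizu_coef x d e f) = nomizu_coef x d e f by rewrite conjc_real.
rewrite conjcB !conjcM !coefJ (XJ c b) (YJ a c) (XJ a c) (YJ c b).
by ring.
Qed.

(** Both sides have the same coordinates in [basis_p], by the Koszul formula; [nomizuC_in_p] makes
    the right-hand side expandable in that basis. *)
Lemma nomizuE x X Y : inv_metric x -> in_p X -> in_p Y ->
  nomizu x X Y = nomizuC x X Y.
Proof.
move=> x_gt0 pX pY; rewrite -[RHS](basis_expansion x_gt0 (nomizuC_in_p x pX pY)).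
apply: eq_bigr => k _; congr ((_ / _)%:C%C *: _); set e := basis_p R k.
rewrite !inv_formE [gsum x X _]gsumC !gsum_proj_p.
(* Cyclicity of the trace moves the bracket with [e] onto the other arguments. *)
have trE A B : gsum x (bracket e A) B = \tr (bracket A (hadamard x B) *m e).
  rewrite gsumC gsum_trl /bracket mulmxBr mulmxBl !raddfB /= !mulmxA.
  by rewrite (mxtrace_mulC _ A) !mulmxA.
have nomE : gsum x (nomizuC x X Y) e *+ 2 =
    gsum x (bracket X Y) e + gsum x (bracket e X) Y + gsum x (bracket e Y) X.
  rewrite !trE !gsum_trl -!mxtraceD -!mulmxDl -hadamard_nomizuC //.
  by rewrite !mulr2n mulmxDl mxtraceD.
have {nomE} := congr1 (@complex.Re R) nomE; rewrite mulr2n !ReD.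
set r4 := complex.Re (gsum x (nomizuC x X Y) e).
move: (complex.Re _) (complex.Re _) (complex.Re _) => r3 r2 r1 E.
have -> : r4 = (r1 + r2 + r3) / 2 by rewrite -E; field.
by rewrite !mulr2n -(mulr_natr r1) -(mulr_natr r2) -(mulr_natr r3) -(mulr_natr (_ / 2)); field.
Qed.

(** Unlike [curvature], this is complex linear in [X] on all matrices, so [trace_linear] applies to
    it. *)
Definition curvatureC x X Y Z : M :=
  nomizuC x X (nomizuC x Y Z) - nomizuC x Y (nomizuC x X Z)
  - nomizuC x (proj_p (bracket X Y)) Z - bracket (proj_t (bracket X Y)) Z.

Lemma proj_bracket_in_p X Y : in_p X -> in_p Y -> in_p (proj_p (bracket X Y)).
Proof.
move=> [_ XJ] [_ YJ]; split=> [a|a b]; first by rewrite mxE eqxx.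
rewrite !mxE eq_sym; case: ifP => _; first by rewrite conjc0 oppr0.
rewrite -!sumrB conjc_sum -sumrN; apply: eq_bigr => c _.
rewrite conjcB !conjcM (XJ c b) (YJ a c) (XJ a c) (YJ c b).
by ring.
Qed.

Lemma curvatureE x X Y Z : inv_metric x -> in_p X -> in_p Y -> in_p Z ->
  curvature x X Y Z = curvatureC x X Y Z.
Proof.
by move=> x_gt0 pX pY pZ; rewrite /curvature !nomizuE //;
  [apply: proj_bracket_in_p | apply: nomizuC_in_p | apply: nomizuC_in_p].
Qed.

Lemma nomizuCDl x X X' Y : nomizuC x (X + X') Y = nomizuC x X Y + nomizuC x X' Y.
Proof.
apply/matrixP => a b; rewrite !mxE; case: eqP => _; first by rewrite addr0.
by rewrite -big_split; apply: eq_bigr => c _; rewrite !mxE /=; ring.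
Qed.

Lemma nomizuCDr x X Y Y' : nomizuC x X (Y + Y') = nomizuC x X Y + nomizuC x X Y'.
Proof.
apply/matrixP => a b; rewrite !mxE; case: eqP => _; first by rewrite addr0.
by rewrite -big_split; apply: eq_bigr => c _; rewrite !mxE /=; ring.
Qed.

Lemma nomizuCZl x k X Y : nomizuC x (k *: X) Y = k *: nomizuC x X Y.
Proof.
apply/matrixP => a b; rewrite !mxE; case: eqP => _; first by rewrite mulr0.
by rewrite mulr_sumr; apply: eq_bigr => c _; rewrite !mxE /=; ring.
Qed.

Lemma nomizuCZr x k X Y : nomizuC x X (k *: Y) = k *: nomizuC x X Y.
Proof.
apply/matrixP => a b; rewrite !mxE; case: eqP => _; first by rewrite mulr0.
by rewrite mulr_sumr; apply: eq_bigr => c _; rewrite !mxE /=; ring.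
Qed.

Lemma bracketDl X X' Y : bracket (X + X') Y = bracket X Y + bracket X' Y.
Proof. by rewrite /bracket mulmxDl mulmxDr opprD addrACA. Qed.

Lemma bracketZl k X Y : bracket (k *: X) Y = k *: bracket X Y.
Proof. by rewrite /bracket -scalemxAl -scalemxAr scalerBr. Qed.

Lemma proj_pD X Y : proj_p (X + Y) = proj_p X + proj_p Y.
Proof. by apply/matrixP => a b; rewrite !mxE; case: eqP; rewrite ?addr0. Qed.

Lemma proj_pZ k X : proj_p (k *: X) = k *: proj_p X.
Proof. by apply/matrixP => a b; rewrite !mxE; case: eqP; rewrite ?mulr0. Qed.

Lemma proj_tD X Y : proj_t (X + Y) = proj_t X + proj_t Y.
Proof. by apply/matrixP => a b; rewrite !mxE; case: eqP; rewrite ?addr0. Qed.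

Lemma proj_tZ k X : proj_t (k *: X) = k *: proj_t X.
Proof. by apply/matrixP => a b; rewrite !mxE; case: eqP; rewrite ?mulr0. Qed.

Lemma curvatureCD x X X' Y Z : curvatureC x (X + X') Y Z = curvatureC x X Y Z + curvatureC x X' Y Z.
Proof.
have sub4 (a a' b b' c c' d d' : M) :
    a + a' - (b + b') - (c + c') - (d + d') = (a - b - c - d) + (a' - b' - c' - d').
  rewrite [- (b + b')]opprD [a + a' + _]addrACA [- (c + c')]opprD.
  by rewrite [_ + (- c - c')]addrACA [- (d + d')]opprD [LHS]addrACA.
by rewrite /curvatureC !(nomizuCDl, nomizuCDr, bracketDl, proj_pD, proj_tD) sub4.
Qed.

Lemma curvatureCZ x k X Y Z : curvatureC x (k *: X) Y Z = k *: curvatureC x X Y Z.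
Proof.
by rewrite /curvatureC !(nomizuCZl, nomizuCZr, bracketZl, proj_pZ, proj_tZ) !scalerBr.
Qed.

Lemma Rc_trace x X Y : inv_metric x -> in_p X -> in_p Y ->
  Rc x X Y =
  complex.Re (\sum_a \sum_(b | b != a) curvatureC x (delta_mx a b) X Y a b).
Proof.
move=> x_gt0 pX pY.
rewrite -(trace_linear (L := fun Z => curvatureC x Z X Y) x_gt0).
- by apply: eq_bigr => k _; rewrite curvatureE //; apply: basis_in_p.
- by move=> *; rewrite curvatureCD.
- by move=> *; rewrite curvatureCZ.
Qed.

End Nomizu.

(** * Ricci and scalar curvature *)

Section RicciFormula.
Variables (R : realType) (n : nat).
Local Notation C := R[i].
Local Notation M := 'M[C]_n.
Implicit Types (X Y Z : M) (x T S : inv_tensor R n) (p : pairs n).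

Lemma ReN (z : C) : complex.Re (- z) = - complex.Re z.
Proof. by case: z. Qed.

(** Row a and column b of Lam(E_ab) Y are what the (a, b) entry of the curvature needs. In each of
    them a single summand survives, because [Y] has zero diagonal. *)
Lemma nomizuC_delta_row x a b Y c : (forall d, Y d d = 0) -> b != a ->
  nomizuC x (delta_mx a b) Y a c = if c == a then 0 else nomizu_coef x a b c * Y b c.
Proof.
move=> Y0 ba; rewrite mxE eq_sym; case: eqVneq => // ca.
rewrite (bigD1 b) //= !mxE !eqxx mul1r big1 => [|d db].
  case: eqVneq => [->|cb]; rewrite ?Y0 ?andbF !(mulr0, mul0r, subr0, addr0) //.
rewrite !mxE (negPf db) andbF mul0r mulr0 sub0r.
have [->|da] := eqVneq d a; first by rewrite Y0 mul0r mulr0 oppr0.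
by rewrite mulr0 mulr0 oppr0.
Qed.

Lemma nomizuC_delta_col x a b Y c : (forall d, Y d d = 0) -> b != a ->
  nomizuC x (delta_mx a b) Y c b = if c == b then 0 else - (nomizu_coef x b a c * Y c a).
Proof.
move=> Y0 ba; rewrite mxE; case: eqVneq => // cb.
rewrite (bigD1 a) //= !mxE !eqxx mulr1 [a == b]eq_sym (negPf ba) andbF mul0r mulr0.
rewrite sub0r big1 ?addr0 // => d da; rewrite !mxE (negPf da) /= !mulr0 subr0.
have [->|db] := eqVneq d b; first by rewrite Y0 !mulr0.
by rewrite andbF mul0r mulr0.
Qed.

Lemma curvatureC_delta x a b X Y : (forall d, X d d = 0) -> (forall d, Y d d = 0) ->
  b != a ->
  curvatureC x (delta_mx a b) X Y a b =
  \sum_(c | (c != a) && (c != b))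
    (nomizu_coef x a c b * nomizu_coef x b a c * (X a c * Y c a)
     + nomizu_coef x b c a * nomizu_coef x a b c * (X c b * Y b c)
     - nomizu_coef x a c b * (X b c * Y c b)
     - nomizu_coef x b c a * (X c a * Y a c)) - (X b a * Y a b) *+ 2.
Proof.
move=> X0 Y0 ba; rewrite /curvatureC.
set W := nomizuC x X Y; set V := nomizuC x (delta_mx a b) Y.
set N := proj_p (bracket (delta_mx a b) X); set D := proj_t _.
have W0 d : W d d = 0 by rewrite mxE eqxx.
have N_row c : N a c = if c == a then 0 else X b c.
  rewrite mxE eq_sym; case: eqVneq => // ca.
  rewrite mxE mul_delta_mx_l eqxx mxE mul_delta_mx_r X0.
  by case: ifP; rewrite subr0.
have N_col c : N c b = if c == b then 0 else - X c a.
  rewrite mxE; case: eqVneq => // cb.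
  rewrite mxE mul_delta_mx_l mxE mul_delta_mx_r eqxx X0.
  by case: ifP; rewrite sub0r.
have D_diag c d : D c d = if c == d then
    (if c == a then X b a else 0) - (if c == b then X b a else 0) else 0.
  rewrite mxE; case: eqVneq => // <-.
  rewrite mxE mul_delta_mx_l mxE mul_delta_mx_r.
  by do 2 (case: eqVneq => [->|_]).
have subE (A B : M) : (A - B) a b = A a b - B a b by rewrite !mxE.
have t4 : bracket D Y a b = (X b a * Y a b) *+ 2.
  rewrite subE mxE (bigD1 a) //= D_diag !eqxx eq_sym (negPf ba) subr0 big1 => [|d da].
    rewrite mxE (bigD1 b) //= D_diag !eqxx (negPf ba) sub0r big1 => [|d db].
      by rewrite !addr0 mulrN opprK [Y a b * _]mulrC mulr2n.
    by rewrite D_diag (negPf db) mulr0.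
  by rewrite D_diag eq_sym (negPf da) mul0r.
have ab : (a == b) = false by rewrite eq_sym (negPf ba).
(* The term Lam(E_ab) Lam(X) Y contributes a multiple of the diagonal entry [W b b], which is 0; the
   bracket with the torus part gives the last term. *)
rewrite 3!subE t4 nomizuC_delta_row // (negPf ba) W0 mulr0 sub0r; congr (_ - _).
rewrite ![nomizuC x _ _ a b]mxE ab -opprD -big_split /= -sumrN.
rewrite [RHS]big_mkcond; apply: eq_bigr => c _.
rewrite N_row N_col /V nomizuC_delta_row // nomizuC_delta_col //.
(* The summands with c = a or c = b vanish, which restricts the sum to c distinct from both. *)
have [->|ca] := eqVneq c a; first by rewrite ?eqxx ?X0 ?Y0 /= !(mul0r, mulr0, subr0, oppr0, addr0).
have [->|cb] := eqVneq c b; first by rewrite ?eqxx ?X0 ?Y0 /= !(mul0r, mulr0, subr0, oppr0, addr0).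
by rewrite /=; ring.
Qed.

Lemma trace_curvatureC x X Y : inv_metric x -> (forall d, X d d = 0) ->
  (forall d, Y d d = 0) ->
  \sum_a \sum_(b | b != a) curvatureC x (delta_mx a b) X Y a b =
  sum_triples (fun a b c => ((sym x a c ^+ 2 + sym x b c ^+ 2 - sym x a b ^+ 2)
     / (2 * sym x a c * sym x b c) - 1)%:C%C * (X a b * Y b a))
  - (\sum_a \sum_(b | b != a) X a b * Y b a) *+ 2.
Proof.
move=> x_gt0 X0 Y0.
transitivity (sum_triples (fun a b c =>
    (nomizu_coef x a c b * nomizu_coef x b a c * (X a c * Y c a)
     + nomizu_coef x b c a * nomizu_coef x a b c * (X c b * Y b c)
     - nomizu_coef x a c b * (X b c * Y c b)
     - nomizu_coef x b c a * (X c a * Y a c)))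
   - (\sum_a \sum_(b | b != a) X b a * Y a b) *+ 2).
  rewrite /sum_triples -!sumrMnl -sumrB; apply: eq_bigr => a _.
  rewrite -!sumrMnl -sumrB; apply: eq_bigr => b ba.
  exact: curvatureC_delta.
congr (_ - _ *+ 2); last first.
  rewrite (exchange_big_dep xpredT) //=; apply: eq_bigr => a _.
  by apply: eq_bigl => b; rewrite eq_sym.
rewrite !(sum_triplesD, sum_triplesN).
(* Relabel the indices of the four sums so that every term carries [X a b * Y b a]; the coefficients
   can then be added. *)
rewrite [X in X + _ - _ - _]sum_triples_swap23.
rewrite [X in _ + X - _ - _]sum_triples_swap23 [X in _ + X - _ - _]sum_triples_swap12
   [X in _ + X - _ - _]sum_triples_swap23.
rewrite [X in _ + _ - X - _]sum_triples_swap12 [X in _ + _ - X - _]sum_triples_swap23.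
rewrite [X in _ + _ - _ - X]sum_triples_swap23 [X in _ + _ - _ - X]sum_triples_swap12.
rewrite -!sum_triplesN -!sum_triplesD; apply: eq_sum_triples => a b c ba ca cb.
set z := _ * Y b a; rewrite /nomizu_coef.
rewrite [sym x c b]symC [sym x b a]symC [sym x c a]symC.
have p0 : sym x a c != 0 by rewrite gt_eqF ?sym_gt0 // eq_sym.
have q0 : sym x b c != 0 by rewrite gt_eqF ?sym_gt0 // eq_sym.
rewrite -!mulNr -!mulrDl -!rmorphM -!rmorphN -!rmorphD; congr (_%:C%C * _).
by field; rewrite p0 q0.
Qed.

(** The eigenvalue on p_ab of the Ricci tensor relative to g, that is 1/(2 x_ab) + 1/(4n) \sum_c
    (x_ab/(x_ac x_bc) - x_ac/(x_ab x_bc) - x_bc/(x_ab x_ac)). *)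
Definition ricci_coef x a b : R :=
  (n%:R + \sum_(c | (c != a) && (c != b))
     (sym x a b ^+ 2 - sym x a c ^+ 2 - sym x b c ^+ 2)
       / (2 * sym x a c * sym x b c)) / (2 * n%:R * sym x a b).

Lemma sumr_neq2 (V : pzRingType) (a b : 'I_n) : b != a ->
  \sum_(c | (c != a) && (c != b)) 1 + 2 = n%:R :> V.
Proof.
move=> ba; rewrite -[n in RHS]card_ord -sum1_card natr_sum [RHS](bigD1 a) //=.
by rewrite [X in _ = _ + X](bigD1 b) //= [RHS]addrC [X in _ = X + _]addrC -addrA.
Qed.

Lemma ricci_coefC x a b : ricci_coef x a b = ricci_coef x b a.
Proof.
rewrite /ricci_coef [sym x b a]symC; congr ((_ + _) / _).
apply: eq_big => c; first by rewrite andbC.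
by move=> _; congr (_ / _); ring.
Qed.

Lemma RcE x X Y : inv_metric x -> in_p X -> in_p Y ->
  Rc x X Y = - complex.Re (\sum_a \sum_(b | b != a)
     (2 * n%:R * sym x a b * ricci_coef x a b)%:C%C * (X a b * Y b a)).
Proof.
move=> x_gt0 pX pY; rewrite Rc_trace // trace_curvatureC //; try by case: pX; case: pY.
rewrite -ReN; congr (complex.Re _); rewrite -sumrN -sumrMnl -sumrB.
apply: eq_bigr => a _; rewrite -sumrN -sumrMnl -sumrB; apply: eq_bigr => b ba.
have n0 : n%:R != 0 :> R by rewrite pnatr_eq0 -lt0n (leq_ltn_trans _ (ltn_ord a)).
have xab : sym x a b != 0 by rewrite gt_eqF ?sym_gt0 // eq_sym.
set z := _ * Y b a; rewrite /ricci_coef [_ * (_ / _)]mulrC divfK; last first.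
  by rewrite !mulf_neq0 // pnatr_eq0.
rewrite -mulr_suml -rmorph_sum.
rewrite -(mulr_natl z 2) -mulrBl -[RHS]mulNr.
rewrite -(rmorph_nat (real_complex R)) -rmorphB.
have realCN (r : R) : (- r)%:C%C = - r%:C%C :> C by exact: rmorphN.
rewrite -realCN; congr (_%:C%C * _).
(* The -1 in each of the n - 2 summands and the -2 from the torus part combine to -n. *)
rewrite sumrB -(sumr_neq2 _ ba); set s1 := (\sum_(_ < n | _) 1).
set s2 := (\sum_(_ < n | _) _ in RHS); set s3 := (\sum_(_ < n | _) _).
have -> : s3 = - s2.
  rewrite -sumrN; apply: eq_bigr => c _; rewrite -[RHS]mulNr.
  by congr (_ / _); ring.
by ring.
Qed.

Lemma Rc_basis x p r : inv_metric x ->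
  Rc x (basis_p R (p, r)) (basis_p R (p, r)) =
    4 * n%:R * x p * ricci_coef x (sval p).1 (sval p).2.
Proof.
move=> x_gt0; rewrite (RcE x_gt0); try exact: basis_in_p.
rewrite -sum_pairs (bigD1 p) //= big1 ?addr0 => [|q qp]; last first.
  by have [-> ->] := basis_p_neq R r qp; rewrite !mulr0 addr0.
have [-> ->] := basis_p_eq R p r.
rewrite [sym x _.2 _]symC sym_pair [ricci_coef x _.2 _]ricci_coefC ReD !ReZ.
by case: r => /=; ring.
Qed.

Lemma ScE x : inv_metric x ->
  Sc x = \sum_a \sum_(b | b != a) ricci_coef x a b.
Proof.
move=> x_gt0; rewrite sum_pairs_sym; last exact: ricci_coefC.
rewrite -sumrMnl /Sc /trace_g.
transitivity (\sum_(p : pairs n) \sum_(r : bool) ricci_coef x (sval p).1 (sval p).2).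
  rewrite pair_bigA; apply: eq_bigr => -[p r] _; rewrite Rc_basis //=.
  rewrite inv_form_basis_basis -(mulr_natr _ 4) -(mulr_natr _ n).
  have n0 : n%:R != 0 :> R by rewrite pnatr_eq0 -lt0n (pair_n_gt0 p).
  by field; rewrite n0 gt_eqF.
by apply: eq_bigr => p _; rewrite big_bool mulr2n.
Qed.

Lemma einstein_criterion x (rho : R) : inv_metric x ->
  (forall a b, b != a -> ricci_coef x a b = rho) -> einstein x.
Proof.
move=> x_gt0 x_E; split=> //; exists rho => X Y pX pY.
rewrite RcE // inv_formE mulrN; congr (- _).
have -> : gsum x X Y = \sum_a \sum_(b | b != a) (sym x a b)%:C%C * (X a b * Y b a).
  by apply: eq_bigr => a _; rewrite (bigD1 a) //= sym_diag mul0r add0r.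
have natE (r : R) : r *+ n *+ 2 = r * (n%:R * 2) by rewrite mulrA !mulr_natr.
rewrite natE !Re_sum !mulr_suml mulr_sumr.
apply: eq_bigr => a _; rewrite !Re_sum !mulr_suml mulr_sumr.
by apply: eq_bigr => b ba; rewrite !ReZ x_E //; ring.
Qed.

Lemma ricci_coefZ (k : R) x a b : k != 0 ->
  ricci_coef (k *: x) a b = k^-1 * ricci_coef x a b.
Proof.
move=> k0; rewrite /ricci_coef symZ.
have -> : 2 * n%:R * (k * sym x a b) = k * (2 * n%:R * sym x a b) by ring.
rewrite [(k * _)^-1]invfM [RHS]mulrCA; congr ((_ + _) * _).
apply: eq_bigr => c _; rewrite !symZ !exprMn -!mulrBr.
have -> : 2 * (k * sym x a c) * (k * sym x b c) =
  k ^+ 2 * (2 * sym x a c * sym x b c) by ring.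
by rewrite -mulf_div divff ?expf_neq0 // mul1r.
Qed.

Lemma trace_invE x T : inv_metric x ->
  trace_g x (inv_form T) = (\sum_p T p / x p) *+ 2.
Proof.
move=> x_gt0; rewrite /trace_g -sumrMnl.
transitivity (\sum_(p : pairs n) \sum_(r : bool) T p / x p).
  rewrite pair_bigA; apply: eq_bigr => -[p r] _ /=.
  rewrite !inv_form_basis_basis -(mulr_natr _ 4) -(mulr_natr (x p *+ n)).
  rewrite -(mulr_natr (T p)) -(mulr_natr (x p)).
  have n0 : n%:R != 0 :> R by rewrite pnatr_eq0 -lt0n (pair_n_gt0 p).
  by field; rewrite n0 gt_eqF.
by apply: eq_bigr => p _; rewrite big_bool mulr2n.
Qed.

Lemma Q_inv_form X Y : (forall a, X a a = 0) -> Q X Y = inv_form [ffun=> 1] X Y.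
Proof.
move=> X0; rewrite inv_formE /Q killingE.
have -> : \tr X = 0 by apply: big1 => a _; apply: X0.
rewrite mul0r subr0; congr (- _).
have <- : \tr (X *m Y) = gsum [ffun=> 1] X Y.
  apply: eq_bigr => a _; rewrite mxE; apply: eq_bigr => b _.
  have [->|/pairP[p]] := eqVneq a b; first by rewrite X0 !mul0r mulr0.
  have := sym_pair ([ffun=> 1] : inv_tensor R n) p; rewrite ffunE.
  by move=> pE [] ep; rewrite ep /= in pE; rewrite ?pE 1?symC ?pE mul1r.
by rewrite mulr2n ReD -(rmorph_nat (real_complex R)) ReZ mulr_natl mulr2n.
Qed.

(** Each p_ij has two basis vectors, so x_ij enters the determinant squared and the square root
    disappears. *)
Lemma volumeE (v : R) x : inv_metric x -> volume v x = v * \prod_p x p.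
Proof.
move=> x_gt0; rewrite /volume; congr (_ * _).
rewrite -[RHS]ger0_norm; last by apply: prodr_ge0 => p _; apply: ltW.
rewrite -sqrtr_sqr; congr (Num.sqrt _); rewrite -prodrXl.
transitivity (\prod_(p : pairs n) \prod_(r : bool) x p).
  rewrite pair_bigA; apply: eq_bigr => -[p r] _ /=.
  rewrite Q_inv_form; last exact: (basis_in_p R (p, r)).1.
  rewrite !inv_form_basis_basis ffunE -(mulr_natr _ 4) -(mulr_natr (x p)).
  rewrite -(mulr_natr (1 *+ n) 4).
  have n0 : n%:R != 0 :> R by rewrite pnatr_eq0 -lt0n (pair_n_gt0 p).
  by field.
by apply: eq_bigr => p _; rewrite big_bool expr2.
Qed.

End RicciFormula.

(** * The Hessian of the scalar curvature *)

Section Hessian.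
Variables (R : realType) (n : nat).
Implicit Types (x T S : inv_tensor R n) (p : pairs n).

Lemma is_derive_bigsum (I : Type) (r : seq I) (P : pred I) (F : I -> R -> R)
    (dF : I -> R) (t : R) :
  (forall i, P i -> is_derive t 1 (F i) (dF i)) ->
  is_derive t 1 (fun s => \sum_(i <- r | P i) F i s) (\sum_(i <- r | P i) dF i).
Proof.
move=> FP; elim: r => [|i r IH].
  rewrite big_nil (_ : (fun _ => _) = cst 0); first exact: is_derive_cst.
  by apply/funext => s; rewrite big_nil.
have [Pi|nPi] := boolP (P i); last first.
  rewrite big_cons (negPf nPi) (_ : (fun _ => _) =
    (fun s => \sum_(i <- r | P i) F i s)) //.
  by apply/funext => s; rewrite big_cons (negPf nPi).
rewrite big_cons Pi (_ : (fun _ => _) =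
    (F i \+ (fun s => \sum_(i <- r | P i) F i s))).
  by apply: is_deriveD; apply: FP.
by apply/funext => s; rewrite big_cons Pi.
Qed.

Lemma is_derive_sum_triples (F : 'I_n -> 'I_n -> 'I_n -> R -> R)
    (dF : 'I_n -> 'I_n -> 'I_n -> R) (t : R) :
  (forall a b c, b != a -> c != a -> c != b ->
     is_derive t 1 (F a b c) (dF a b c)) ->
  is_derive t 1 (fun s => sum_triples (fun a b c => F a b c s)) (sum_triples dF).
Proof.
move=> FP; apply: is_derive_bigsum => a _; apply: is_derive_bigsum => b ba.
by apply: is_derive_bigsum => c /andP[ca cb]; apply: FP.
Qed.

Lemma is_derive_sym (U : R -> inv_tensor R n) (dU : inv_tensor R n) (t : R) a b :
  (forall p, is_derive t 1 (fun s => U s p : R) (dU p)) ->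
  is_derive t 1 (fun s => sym (U s) a b : R) (sym dU a b).
Proof. by move=> UP; apply: is_derive_bigsum. Qed.

Lemma is_derive_expR_comp (w : R -> R) (dw t : R) : is_derive t 1 w dw ->
  is_derive t 1 (fun s => expR (w s)) (dw * expR (w t)).
Proof.
move=> wP; rewrite mulrC; exact: (is_derive1_comp (f := expR)).
Qed.

(** This yields (exp w)'' = (w'^2 + w'') exp w, from which both the Hessian and its correction term
    arise. *)
Lemma is_derive_expR_comp2 (w dw : R -> R) (ddw t : R) :
  is_derive t 1 w (dw t) -> is_derive t 1 dw ddw ->
  is_derive t 1 (fun s => dw s * expR (w s)) ((dw t ^+ 2 + ddw) * expR (w t)).
Proof.
move=> wP dwP; have := is_deriveM dwP (is_derive_expR_comp wP).
by move=> H; apply: (is_derive_eq H); rewrite /GRing.scale /=; ring.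
Qed.

Lemma is_derive_derive1n2 (f df : R -> R) (ddf t : R) :
  (forall s : R, is_derive s 1 f (df s)) -> is_derive t 1 df ddf ->
  derive1n 2 f t = ddf.
Proof.
move=> fP dfP; rewrite /derive1n /= (_ : derive1 f = df).
  by rewrite derive1E; case: dfP.
by apply/funext => s; rewrite derive1E; case: (fP s).
Qed.

Lemma is_derive_derive1 (f : R -> R) (t : R) : derivable f t 1 ->
  is_derive t 1 f (derive1 f t).
Proof. by move=> fP; rewrite derive1E; exact: derivableP. Qed.

(** In the coordinates u = ln x this is the exponential of u_ab - u_ac - u_bc. *)
Definition sc_monomial x a b c : R := sym x a b / (sym x a c * sym x b c).

(* The left-hand side is minus the derivative of Sc in the direction w of the
   coordinates ln x. *)
Lemma ricci_weighted x (w : 'I_n -> 'I_n -> R) : inv_metric x ->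
  (forall a b, w a b = w b a) ->
  \sum_a \sum_(b | b != a) ricci_coef x a b * w a b =
  \sum_a \sum_(b | b != a) w a b / (2 * sym x a b) +
  (4 * n%:R)^-1 *
    sum_triples (fun a b c => sc_monomial x a b c * (w a b - w a c - w b c)).
Proof.
move=> x_gt0 wC.
transitivity (\sum_a \sum_(b | b != a) w a b / (2 * sym x a b) +
  (4 * n%:R)^-1 * sum_triples (fun a b c => (sc_monomial x a b c - sc_monomial x a c b
     - sc_monomial x b c a) * w a b)).
  rewrite -sum_triples_mulr -big_split; apply: eq_bigr => a _.
  rewrite -big_split; apply: eq_bigr => b ba /=.
  have n0 : n%:R != 0 :> R by rewrite pnatr_eq0 -lt0n (leq_ltn_trans _ (ltn_ord a)).
  have xab : sym x a b != 0 by rewrite gt_eqF ?sym_gt0 // eq_sym.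
  rewrite /ricci_coef mulrDl mulrDl; congr (_ + _).
    by field; rewrite n0 xab.
  rewrite !mulr_suml; apply: eq_bigr => c /andP[ca cb].
  rewrite /sc_monomial [sym x c b]symC [sym x b a]symC [sym x c a]symC.
  have xac : sym x a c != 0 by rewrite gt_eqF ?sym_gt0 // eq_sym.
  have xbc : sym x b c != 0 by rewrite gt_eqF ?sym_gt0 // eq_sym.
  by field; rewrite n0 xab xac xbc.
congr (_ + _ * _).
transitivity (sum_triples (fun a b c => sc_monomial x a b c * w a b)
   - sum_triples (fun a b c => sc_monomial x a b c * w a c)
   - sum_triples (fun a b c => sc_monomial x a b c * w b c)); last first.
  rewrite -!sum_triplesN -!sum_triplesD; apply: eq_sum_triples => a b c _ _ _; ring.
(* Permute the indices so that each of the three sums is weighted by [w a b]. *)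
rewrite [in X in _ - X - _]sum_triples_swap23.
rewrite [in X in _ - _ - X]sum_triples_swap12 [in X in _ - _ - X]sum_triples_swap23
  [in X in _ - _ - X]sum_triples_swap12.
rewrite -!sum_triplesN -!sum_triplesD; apply: eq_sum_triples => a b c _ _ _.
rewrite [w b a]wC /sc_monomial [sym x c b]symC [sym x c a * _]mulrC.
rewrite [sym x c a]symC; ring.
Qed.

(** With all weights equal to 1 in [ricci_weighted], each triple gets the weight 1 - 1 - 1 = -1. *)
Lemma Sc_monomials x : inv_metric x ->
  Sc x = \sum_a \sum_(b | b != a) (2 * sym x a b)^-1
    - (4 * n%:R)^-1 * sum_triples (sc_monomial x).
Proof.
move=> x_gt0; rewrite ScE //.
transitivity (\sum_a \sum_(b | b != a) ricci_coef x a b * 1).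
  by apply: eq_bigr => a _; apply: eq_bigr => b _; rewrite mulr1.
rewrite (ricci_weighted (w := fun _ _ => 1)) // -mulrN -[- sum_triples _]mulN1r.
rewrite -(sum_triples_mulr (-1)); congr (_ + _ * _).
  by apply: eq_bigr => a _; apply: eq_bigr => b _; rewrite mul1r.
by apply: eq_sum_triples => a b c _ _ _; ring.
Qed.

(** The direction [T] in the coordinates ln x, called tau in the introduction. *)
Definition log_dir x T : inv_tensor R n := [ffun p => T p / x p].

Definition hess x T S : R :=
  \sum_a \sum_(b | b != a)
    sym (log_dir x T) a b * sym (log_dir x S) a b / (2 * sym x a b)
  - (4 * n%:R)^-1 * sum_triples (fun a b c => sc_monomial x a b c *
    ((sym (log_dir x T) a b - sym (log_dir x T) a c - sym (log_dir x T) b c) *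
     (sym (log_dir x S) a b - sym (log_dir x S) a c - sym (log_dir x S) b c))).

Lemma sym_log_dirZ x (k : R) T1 T2 a b :
  sym (log_dir x (k *: T1 + T2)) a b =
  k * sym (log_dir x T1) a b + sym (log_dir x T2) a b.
Proof.
rewrite /sym mulr_sumr -big_split; apply: eq_bigr => p _.
by rewrite !ffunE mulrDl mulrA.
Qed.

Lemma hessC x T S : hess x T S = hess x S T.
Proof.
rewrite /hess; congr (_ - _ * _); last first.
  by apply: eq_sum_triples => a b c _ _ _; rewrite [X in _ * X]mulrC.
by apply: eq_bigr => a _; apply: eq_bigr => b _; rewrite [X in X / _]mulrC.
Qed.

Lemma hess_linear x (k : R) T1 T2 S :
  hess x (k *: T1 + T2) S = k * hess x T1 S + hess x T2 S.
Proof.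
rewrite /hess mulrBr addrACA -opprD mulrCA -mulrDr
  -(sum_triples_mulr k) -sum_triplesD.
congr (_ - _ * _); last first.
  by apply: eq_sum_triples => a b c _ _ _; rewrite !sym_log_dirZ; ring.
rewrite mulr_sumr -big_split; apply: eq_bigr => a _; rewrite mulr_sumr -big_split.
by apply: eq_bigr => b _; rewrite sym_log_dirZ /=; ring.
Qed.

(* The terms in U2 add up to -rho \sum_(a != b) U2_ab by ricci_weighted. *)
Lemma Sc_log_curve (U U1 : R -> inv_tensor R n) (U2 : inv_tensor R n) (rho : R) :
  (forall p (t : R), is_derive t 1 (fun s => U s p : R) (U1 t p)) ->
  (forall p, is_derive (0 : R) 1 (fun s => U1 s p : R) (U2 p)) ->
  let expU t : inv_tensor R n := [ffun p => expR (U t p)] in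
  (forall a b, b != a -> ricci_coef (expU 0) a b = rho) ->
  \sum_p U2 p = 0 ->
  derive1n 2 (fun t => Sc (expU t)) 0 =
  hess (expU 0) [ffun p => expU 0 p * U1 0 p] [ffun p => expU 0 p * U1 0 p].
Proof.
move=> UP U1P expU ricE U2_0.
have expU_gt0 t p : 0 < expU t p by rewrite ffunE expR_gt0.
have symE t a b : b != a -> sym (expU t) a b = expR (sym (U t) a b).
  rewrite eq_sym => /pairP[p]; have := sym_pair (expU t) p; have := sym_pair (U t) p.
  rewrite ffunE => e1 e2 [] ep; rewrite ep /= in e1 e2; first by rewrite e1 e2.
  by rewrite symC [sym (U t) a b]symC e1 e2.
have monoE t a b c : b != a -> c != a -> c != b -> sc_monomial (expU t) a b c =
    expR (sym (U t) a b - sym (U t) a c - sym (U t) b c).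
  by move=> ba ca cb; rewrite /sc_monomial !symE // -expRD -expRB opprD addrA.
pose f t := \sum_a \sum_(b | b != a) 2^-1 * expR (- sym (U t) a b)
  - (4 * n%:R)^-1 * sum_triples (fun a b c => expR (sym (U t) a b - sym (U t) a c - sym (U t) b c)).
pose f1 t := \sum_a \sum_(b | b != a) 2^-1 * (- sym (U1 t) a b * expR (- sym (U t) a b))
  - (4 * n%:R)^-1 * sum_triples (fun a b c =>
     (sym (U1 t) a b - sym (U1 t) a c - sym (U1 t) b c) *
     expR (sym (U t) a b - sym (U t) a c - sym (U t) b c)).
pose f2 : R := \sum_a \sum_(b | b != a) 2^-1 *
     (((- sym (U1 0) a b) ^+ 2 + (- sym U2 a b)) * expR (- sym (U 0) a b))
  - (4 * n%:R)^-1 * sum_triples (fun a b c =>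
     ((sym (U1 0) a b - sym (U1 0) a c - sym (U1 0) b c) ^+ 2
       + (sym U2 a b - sym U2 a c - sym U2 b c)) *
     expR (sym (U 0) a b - sym (U 0) a c - sym (U 0) b c)).
have -> : (fun t => Sc (expU t)) = f.
  apply/funext => t; rewrite Sc_monomials // /f; congr (_ - _ * _); last first.
    by apply: eq_sum_triples => a b c; apply: monoE.
  apply: eq_bigr => a _; apply: eq_bigr => b ba.
  by rewrite symE // invfM expRN.
have symP (t : R) a b : is_derive t 1 (fun s => sym (U s) a b) (sym (U1 t) a b).
  by apply: is_derive_sym => p; apply: UP.
have sym1P a b : is_derive (0 : R) 1 (fun s => sym (U1 s) a b) (sym U2 a b).
  by apply: is_derive_sym => p; apply: U1P.
have scaleP (k t : R) (h : R -> R) (dh : R) : is_derive t 1 h dh ->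
    is_derive t 1 (fun s => k * h s) (k * dh).
  by move=> hP; exact: is_deriveZ.
have fP (t : R) : is_derive t 1 f (f1 t).
  apply: is_deriveB.
    apply: is_derive_bigsum => a _; apply: is_derive_bigsum => b ba.
    by apply: scaleP; apply: is_derive_expR_comp; apply: is_deriveN.
  apply: scaleP; apply: is_derive_sum_triples => a b c _ _ _.
  by apply: is_derive_expR_comp; apply: is_deriveB.
have f1P : is_derive (0 : R) 1 f1 f2.
  apply: is_deriveB.
    apply: is_derive_bigsum => a _; apply: is_derive_bigsum => b ba.
    apply: scaleP.
    apply: (is_derive_expR_comp2 (w := fun s => - sym (U s) a b)
      (dw := fun s => - sym (U1 s) a b)); exact: is_deriveN.
  apply: scaleP; apply: is_derive_sum_triples => a b c _ _ _.
  apply: (is_derive_expR_comp2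
     (w := fun s => sym (U s) a b - sym (U s) a c - sym (U s) b c)
     (dw := fun s => sym (U1 s) a b - sym (U1 s) a c - sym (U1 s) b c));
    exact: is_deriveB.
rewrite (is_derive_derive1n2 fP f1P).
have ldE : log_dir (expU 0) [ffun p => expU 0 p * U1 0 p] = U1 0.
  by apply/ffunP => p; rewrite !ffunE mulrAC divff ?mul1r // gt_eqF ?expR_gt0.
rewrite /hess ldE.
have ricW := ricci_weighted (expU_gt0 0) (symC U2).
have ric0 : \sum_a \sum_(b | b != a) ricci_coef (expU 0) a b * sym U2 a b = 0.
  (* The Einstein condition makes the Ricci coefficients constant, and what remains is twice the sum
     of [U2]. *)
  transitivity (rho * \sum_a \sum_(b | b != a) sym U2 a b).
    rewrite mulr_sumr; apply: eq_bigr => a _; rewrite mulr_sumr.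
    by apply: eq_bigr => b ba; rewrite ricE.
  rewrite sum_pairs_sym; last exact: symC.
  by under eq_bigr => p _ do rewrite sym_pair; rewrite U2_0 mul0rn mulr0.
rewrite {}ric0 in ricW.
(* The [U2] terms of [f2] add up to minus the right-hand side of [ricW], which equals 0. Subtracting
   this zero from the Hessian allows a termwise comparison. *)
rewrite -[RHS]subr0 [X in _ = _ - X]ricW opprD addrACA -opprD -mulrDr -sum_triplesD.
congr (_ - _ * _); last first.
  by apply: eq_sum_triples => a b c ba ca cb; rewrite monoE //; ring.
rewrite -sumrB; apply: eq_bigr => a _; rewrite -sumrB; apply: eq_bigr => b ba.
rewrite symE // expRN invfM sqrrN expr2 /=; ring.
Qed.

Lemma ln_prod (I : Type) (r : seq I) (F : I -> R) : (forall i, 0 < F i) ->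
  ln (\prod_(i <- r) F i) = \sum_(i <- r) ln (F i).
Proof.
move=> F_gt0; elim: r => [|i r IH]; first by rewrite !big_nil ln1.
by rewrite !big_cons lnM ?IH // posrE // prodr_gt0.
Qed.

(** Pass to U = ln c, where [Sc_log_curve] applies; its condition on the second derivatives comes
    from the constant volume. *)
Lemma hess_is_hessian (v : R) x (rho : R) : 0 < v -> inv_metric x ->
  (forall a b, b != a -> ricci_coef x a b = rho) -> is_hessian v x (hess x).
Proof.
move=> v_gt0 x_gt0 ricE; split; [exact: hessC|exact: hess_linear|].
move=> T c TT_T M1c c_diff c0 c'0.
have c_gt0 t p : 0 < c t p by case: (M1c t) => + _; apply.
pose c1 t : inv_tensor R n := [ffun p => derive1 (fun s => c s p : R) t].
pose U t : inv_tensor R n := [ffun p => ln (c t p)].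
pose U1 t : inv_tensor R n := [ffun p => c1 t p / c t p].
pose U2 : inv_tensor R n := [ffun p => derive1 (fun t => U1 t p : R) 0].
have cP p (t : R) : is_derive t 1 (fun s => c s p : R) (c1 t p).
  by rewrite ffunE; apply: is_derive_derive1; have [] := c_diff p t.
have UP p (t : R) : is_derive t 1 (fun s => U s p : R) (U1 t p).
  rewrite (_ : (fun _ => _) = (fun s => ln (c s p))); last first.
    by apply/funext => s; rewrite ffunE.
  rewrite ffunE mulrC.
  exact: (is_derive1_comp (is_derive1_ln (c_gt0 t p)) (cP p t)).
have U1P p : is_derive (0 : R) 1 (fun s => U1 s p : R) (U2 p).
  rewrite [U2 p]ffunE; apply: is_derive_derive1.
  rewrite (_ : (fun _ => _) = (fun s => derive1 (fun s => c s p : R) s * (c s p)^-1)); last first.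
    by apply/funext => s; rewrite !ffunE.
  apply: derivableM; first by have [] := c_diff p 0.
  by apply: derivableV; [rewrite gt_eqF | have [] := c_diff p 0].
have cE t : c t = [ffun p => expR (U t p)].
  by apply/ffunP => p; rewrite !ffunE lnK // posrE.
(* By [volumeE], unit volume means that the sum of the logarithms is the constant ln(1/v).
   Differentiate this twice. *)
have U2_0 : \sum_p U2 p = 0.
  have U_cst : (fun t : R => \sum_p U t p) = cst (ln (v^-1)).
    apply/funext => t; rewrite /cst -[in RHS](mulr1 v^-1).
    have [_ <-] := M1c t; rewrite volumeE // mulKf ?gt_eqF // ln_prod //.
    by apply: eq_bigr => p _; rewrite ffunE.
  have U1_0 : (fun t : R => \sum_p U1 t p) = cst 0.
    apply/funext => t.
    have : is_derive t 1 (fun t : R => \sum_p U t p) (\sum_p U1 t p).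
      by apply: is_derive_bigsum => p _; apply: UP.
    by rewrite U_cst => -[_ <-]; rewrite derive_cst.
  have : is_derive (0 : R) 1 (fun t : R => \sum_p U1 t p) (\sum_p U2 p).
    by apply: is_derive_bigsum => p _; apply: U1P.
  by rewrite U1_0 => -[_ <-]; rewrite derive_cst.
have -> : (fun t => Sc (c t)) = (fun t => Sc [ffun p => expR (U t p)]).
  by apply/funext => t; rewrite -cE.
have xE : x = [ffun p => expR (U 0 p)] by rewrite -cE c0.
rewrite (Sc_log_curve UP U1P (rho := rho)) //; last by move=> a b; rewrite -xE; apply: ricE.
rewrite -xE; suff -> : [ffun p => x p * U1 0 p] = T by [].
by apply/ffunP => p; rewrite !ffunE c'0 c0 mulrC divfK // gt_eqF.
Qed.

End Hessian.

(** * Normalization of the volume and logarithmic directions *)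

Section Scaling.
Variables (R : realType) (n : nat).
Implicit Types (x T S : inv_tensor R n) (p : pairs n).

Lemma unit_volume_scaling (v : R) x : (0 < #|{: pairs n}|)%N -> 0 < v ->
  inv_metric x -> exists2 k : R, 0 < k & M1 v (k *: x).
Proof.
move=> n_gt0 v_gt0 x_gt0; set m := #|_| in n_gt0.
have y_gt0 : 0 < (v * \prod_p x p)^-1.
  by rewrite invr_gt0 mulr_gt0 // prodr_gt0.
(* The volume is homogeneous of degree m, the number of pairs, so [k] is the m-th root of the
   inverse volume of [x]. *)
pose k := expR (ln (v * \prod_p x p)^-1 / m%:R).
have k_gt0 : 0 < k := expR_gt0 _.
have kx_gt0 : inv_metric (k *: x) by move=> p; rewrite ffunE mulr_gt0.
exists k => //; split=> //; rewrite volumeE //.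
under eq_bigr => p _ do rewrite ffunE.
rewrite big_split /= prodr_const -/m -expRM_natl [X in expR X]mulrC divfK ?pnatr_eq0 -?lt0n //.
by rewrite lnK ?posrE // mulrCA mulVf // gt_eqF // mulr_gt0 // prodr_gt0.
Qed.

Lemma TT_log_dir x T : inv_metric x ->
  TT x T <-> \sum_a \sum_(b | b != a) sym (log_dir x T) a b = 0.
Proof.
move=> x_gt0; rewrite /TT trace_invE // sum_pairs_sym; last exact: symC.
by under [in X in _ <-> X]eq_bigr => p _ do rewrite sym_pair ffunE.
Qed.

(** Inverse to [log_dir]; it builds test tensors from prescribed logarithmic coordinates. *)
Definition of_log_dir x (F : 'I_n -> 'I_n -> R) : inv_tensor R n :=
  [ffun p => x p * F (sval p).1 (sval p).2].

Lemma sym_of_log_dir x F a b : inv_metric x -> (forall a b, F a b = F b a) ->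
  a != b -> sym (log_dir x (of_log_dir x F)) a b = F a b.
Proof.
move=> x_gt0 FC /pairP[p ep].
have := sym_pair (log_dir x (of_log_dir x F)) p.
rewrite !ffunE mulrC mulKf ?gt_eqF //.
by case: ep => -> /= e; [|rewrite symC FC].
Qed.

End Scaling.

(** * The metric gA *)

Local Notation o0 := (@Ordinal 5 0 isT).
Local Notation o1 := (@Ordinal 5 1 isT).
Local Notation o2 := (@Ordinal 5 2 isT).
Local Notation o3 := (@Ordinal 5 3 isT).
Local Notation o4 := (@Ordinal 5 4 isT).

Section Five.
Variable R : realType.
Implicit Types (x T S : inv_tensor R 5).

Lemma sum5 (F : 'I_5 -> R) : \sum_i F i = F o0 + F o1 + F o2 + F o3 + F o4.
Proof.
rewrite !big_ord_recr big_ord0 /= add0r.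
by do !congr (_ + _); congr F; apply: val_inj.
Qed.

Lemma gA_gt0 : inv_metric (gA R).
Proof. by move=> p; rewrite ffunE; case: ifP => _; lra. Qed.

Lemma sym_gA a b : a != b ->
  sym (gA R) a b = if (a == o0) || (b == o0) then 1 else 3 / 2.
Proof.
move=> /pairP[[[c d] /= cd] ep]; have := sym_pair (gA R) (exist _ (c, d) cd).
rewrite ffunE /= => e.
have cdE : (val c == 0%N) = (c == o0) || (d == o0) by rewrite -!val_eqE /=; lia.
case: ep => -[] <- <-; first by rewrite e cdE.
by rewrite symC e cdE orbC.
Qed.

(** There are two kinds of pairs: those containing [o0] give 1/2 - (3/20)(3/2), the others 1/3 +
    (1/20)(1/6 - 4/3). Both values are 11/40. *)
Lemma ricci_gA a b : b != a -> ricci_coef (gA R) a b = 11 / 40.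
Proof.
move=> ba; rewrite /ricci_coef.
have -> : \sum_(c < 5 | (c != a) && (c != b))
     (sym (gA R) a b ^+ 2 - sym (gA R) a c ^+ 2 - sym (gA R) b c ^+ 2)
       / (2 * sym (gA R) a c * sym (gA R) b c) =
  \sum_(c < 5 | (c != a) && (c != b))
   let g (c d : 'I_5) : R := if (c == o0) || (d == o0) then 1 else 3 / 2 in
     (g a b ^+ 2 - g a c ^+ 2 - g b c ^+ 2) / (2 * g a c * g b c).
  apply: eq_bigr => c /andP[ca cb]; rewrite !sym_gA //; by rewrite eq_sym.
rewrite sym_gA 1?eq_sym // big_mkcond sum5.
move: ba; case: a => [[|[|[|[|[|//]]]]] ?]; case: b => [[|[|[|[|[|//]]]]] ?] //= _; lra.
Qed.

(* hess (gA R) in logarithmic coordinates t and s; the sums run over the edges and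
   triangles of the complete graph on 'I_5, with apex o0 and base o1, ..., o4. *)
Definition hess_form (t s : 'I_5 -> 'I_5 -> R) : R :=
  t o0 o1 * s o0 o1 + t o0 o2 * s o0 o2 + t o0 o3 * s o0 o3 + t o0 o4 * s o0 o4
  + 2 / 3 * (t o1 o2 * s o1 o2 + t o1 o3 * s o1 o3 + t o1 o4 * s o1 o4
             + t o2 o3 * s o2 o3 + t o2 o4 * s o2 o4 + t o3 o4 * s o3 o4)
  - 1 / 10 *
    (let tri a b c := (t a b - t a c - t b c) * (s a b - s a c - s b c) in
     let base a b := 3 / 2 * tri a b o0 + 2 / 3 * (tri o0 a b + tri o0 b a) in
     let face a b c := 2 / 3 * (tri a b c + tri a c b + tri b c a) in
     base o1 o2 + base o1 o3 + base o1 o4 + base o2 o3 + base o2 o4 + base o3 o4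
     + face o1 o2 o3 + face o1 o2 o4 + face o1 o3 o4 + face o2 o3 o4).

(** In fixed logarithmic directions every term is homogeneous of degree -1 in the metric, which
    gives the factor 1/k. *)
Lemma hess_gA (k : R) T S : 0 < k ->
  hess (k *: gA R) T S =
  k^-1 * hess_form (sym (log_dir (k *: gA R) T)) (sym (log_dir (k *: gA R) S)).
Proof.
move=> k_gt0; rewrite /hess.
have := symC (log_dir (k *: gA R) T); have := symC (log_dir (k *: gA R) S).
set t := sym (log_dir _ T); set s := sym (log_dir _ S) => sC tC.
pose g (c d : 'I_5) : R := if (c == o0) || (d == o0) then 1 else 3 / 2.
have xE a b : a != b -> sym (k *: gA R) a b = k * g a b.
  by move=> ab; rewrite symZ sym_gA.
have -> : sum_triples (fun a b c => sc_monomial (k *: gA R) a b c *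
    ((t a b - t a c - t b c) * (s a b - s a c - s b c))) =
  k^-1 * sum_triples (fun a b c => g a b / (g a c * g b c) *
    ((t a b - t a c - t b c) * (s a b - s a c - s b c))).
  rewrite -sum_triples_mulr; apply: eq_sum_triples => a b c ba ca cb.
  have gN0 d e : g d e != 0 by rewrite /g; case: ifP => _; lra.
  rewrite /sc_monomial !xE 1?eq_sym //.
  by field; rewrite !gN0 gt_eqF.
have -> : \sum_a \sum_(b | b != a) t a b * s a b / (2 * sym (k *: gA R) a b) =
  k^-1 * \sum_a \sum_(b | b != a) t a b * s a b / (2 * g a b).
  rewrite mulr_sumr; apply: eq_bigr => a _; rewrite mulr_sumr.
  apply: eq_bigr => b ba; rewrite xE 1?eq_sym //.
  have gN0 : g a b != 0 by rewrite /g; case: ifP => _; lra.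
  by field; rewrite gN0 gt_eqF.
rewrite mulrCA -mulrBr; congr (_ * _).
have -> : \sum_a \sum_(b | b != a) t a b * s a b / (2 * g a b) =
    \sum_a \sum_b if b != a then t a b * s a b / (2 * g a b) else 0.
  by apply: eq_bigr => a _; rewrite big_mkcond.
(* Every unordered pair {a, b} occurs twice: 1/(2 x_ab) becomes 1 or 2/3, and 1/(4n) = 1/20 becomes
   1/10. The monomials are 3/2 or 2/3 on triangles with the apex and 2/3 on the others. *)
rewrite sum_triplesE !sum5 /hess_form /g /=.
rewrite !(tC o1 o0, tC o2 o0, tC o3 o0, tC o4 o0, tC o2 o1, tC o3 o1, tC o4 o1,
  tC o3 o2, tC o4 o2, tC o4 o3, sC o1 o0, sC o2 o0, sC o3 o0, sC o4 o0, sC o2 o1,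
  sC o3 o1, sC o4 o1, sC o3 o2, sC o4 o2, sC o4 o3).
by field.
Qed.

(** [F] may be nonzero on the diagonal, where [sym] is 0, but [hess_form] only evaluates its
    arguments off the diagonal. *)
Lemma hess_form_log_dir t k (F : 'I_5 -> 'I_5 -> R) : 0 < k ->
  (forall a b, F a b = F b a) ->
  hess_form t (sym (log_dir (k *: gA R) (of_log_dir (k *: gA R) F))) = hess_form t F.
Proof.
move=> k_gt0 FC.
have x_gt0 : inv_metric (k *: gA R) by move=> p; rewrite ffunE mulr_gt0 ?gA_gt0.
by rewrite /hess_form /= !(sym_of_log_dir x_gt0 FC).
Qed.

Definition sum_edges (t : 'I_5 -> 'I_5 -> R) : R :=
  t o0 o1 + t o0 o2 + t o0 o3 + t o0 o4 + t o1 o2 + t o1 o3 + t o1 o4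
  + t o2 o3 + t o2 o4 + t o3 o4.

Lemma TT_gA k T : 0 < k ->
  TT (k *: gA R) T <-> sum_edges (sym (log_dir (k *: gA R) T)) = 0.
Proof.
move=> k_gt0; have x_gt0 : inv_metric (k *: gA R).
  by move=> p; rewrite ffunE mulr_gt0 ?gA_gt0.
rewrite TT_log_dir //; have := symC (log_dir (k *: gA R) T).
set t := sym _ => tC.
have -> : \sum_a \sum_(b | b != a) t a b = \sum_a \sum_b if b != a then t a b else 0.
  by apply: eq_bigr => a _; rewrite big_mkcond.
rewrite !sum5 /= !(tC o1 o0, tC o2 o0, tC o3 o0, tC o4 o0, tC o2 o1, tC o3 o1, tC o4 o1,
  tC o3 o2, tC o4 o2, tC o4 o3) /sum_edges.
by split=> ?; lra.
Qed.

Lemma log_dir_eq0 x T : inv_metric x ->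
  (forall a b : 'I_5, (a < b)%N -> sym (log_dir x T) a b = 0) -> T = 0.
Proof.
move=> x_gt0 T0; apply/ffunP => p; have := sym_pair (log_dir x T) p.
rewrite T0 ?(svalP p) // !ffunE => /esym/eqP.
by rewrite mulf_eq0 invr_eq0 (gt_eqF (x_gt0 p)) orbF => /eqP.
Qed.

(* The map J of the introduction: on base edges it is -t, and on the edges t_0j it
   subtracts twice the mean. *)
Definition flip_tensor (t : 'I_5 -> 'I_5 -> R) (a b : 'I_5) : R :=
  if (a == o0) || (b == o0) then t a b - (t o0 o1 + t o0 o2 + t o0 o3 + t o0 o4) / 2
  else - t a b.

Lemma flip_tensorC t a b : (forall a b, t a b = t b a) -> flip_tensor t a b = flip_tensor t b a.
Proof. by move=> tC; rewrite /flip_tensor orbC tC. Qed.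

Lemma sum_edges_flip t : sum_edges t = 0 -> sum_edges (flip_tensor t) = 0.
Proof. by rewrite /sum_edges /flip_tensor /= => t0; lra. Qed.

(** The opposite signs of the two standard components cancel their cross terms in H(tau, J tau). The
    squares are, in order, the standard component of s, the trivial line, the standard component of
    t (vertex sums minus their mean -u/2), and the plane (differences of sums over perfect
    matchings). *)
Lemma hess_form_flip t : (forall a b, t a b = t b a) -> sum_edges t = 0 ->
  let u := t o0 o1 + t o0 o2 + t o0 o3 + t o0 o4 in
  hess_form t (flip_tensor t) =
    ((t o0 o1 - u / 4) ^+ 2 + (t o0 o2 - u / 4) ^+ 2
     + (t o0 o3 - u / 4) ^+ 2 + (t o0 o4 - u / 4) ^+ 2) / 6
    + u ^+ 2 / 12
    + ((t o1 o2 + t o1 o3 + t o1 o4 + u / 2) ^+ 2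
       + (t o1 o2 + t o2 o3 + t o2 o4 + u / 2) ^+ 2
       + (t o1 o3 + t o2 o3 + t o3 o4 + u / 2) ^+ 2
       + (t o1 o4 + t o2 o4 + t o3 o4 + u / 2) ^+ 2) / 120
    + ((t o1 o2 + t o3 o4 - t o1 o3 - t o2 o4) ^+ 2
       + (t o1 o2 + t o3 o4 - t o1 o4 - t o2 o3) ^+ 2
       + (t o1 o3 + t o2 o4 - t o1 o4 - t o2 o3) ^+ 2) / 40.
Proof.
move=> tC t0 u; rewrite /sum_edges in t0.
have t34 : t o3 o4 = - (u + t o1 o2 + t o1 o3 + t o1 o4 + t o2 o3 + t o2 o4).
  by rewrite /u; lra.
rewrite /hess_form /flip_tensor /= !(tC o1 o0, tC o2 o0, tC o3 o0, tC o4 o0, tC o2 o1,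
  tC o3 o1, tC o4 o1, tC o3 o2, tC o4 o2, tC o4 o3) t34 /u.
by field.
Qed.

Lemma hess_form_flip_ge0 t : (forall a b, t a b = t b a) -> sum_edges t = 0 ->
  0 <= hess_form t (flip_tensor t).
Proof.
move=> tC t0; rewrite hess_form_flip //=.
by do ?[apply: addr_ge0 | exact: sqr_ge0 | apply: divr_ge0].
Qed.

Lemma hess_form_flip_eq0 t : (forall a b, t a b = t b a) -> sum_edges t = 0 ->
  hess_form t (flip_tensor t) = 0 -> forall a b : 'I_5, (a < b)%N -> t a b = 0.
Proof.
move=> tC t0; rewrite hess_form_flip //=; move: t0; rewrite /sum_edges.
set u := t o0 o1 + t o0 o2 + t o0 o3 + t o0 o4.
set a1 := t o0 o1 - _; set a2 := t o0 o2 - _; set a3 := t o0 o3 - _.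
set a4 := t o0 o4 - _; set d1 := t o1 o2 + t o1 o3 + t o1 o4 + u / 2.
set d2 := t o1 o2 + t o2 o3 + t o2 o4 + u / 2.
set d3 := t o1 o3 + t o2 o3 + t o3 o4 + u / 2.
set d4 := t o1 o4 + t o2 o4 + t o3 o4 + u / 2.
set m1 := _ - t o1 o3 - t o2 o4.
set m2 := t o1 o2 + _ - t o1 o4 - t o2 o3.
set m3 := t o1 o3 + _ - t o1 o4 - t o2 o3 => t0 sos0.
have sq0 z : z ^+ 2 <= 0 -> z = 0 :> R.
  by move=> z0; apply/eqP; rewrite -sqrf_eq0 eq_le z0 sqr_ge0.
have [] : [/\ u = 0, [/\ a1 = 0, a2 = 0, a3 = 0 & a4 = 0],
    [/\ d1 = 0, d2 = 0, d3 = 0 & d4 = 0] & [/\ m1 = 0, m2 = 0 & m3 = 0]].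
  have := (sqr_ge0 u, sqr_ge0 a1, sqr_ge0 a2, sqr_ge0 a3, sqr_ge0 a4, sqr_ge0 d1,
    sqr_ge0 d2, sqr_ge0 d3, sqr_ge0 d4, (sqr_ge0 m1, sqr_ge0 m2, sqr_ge0 m3)).
  (* With the linear forms made opaque, bounding each square by 0 is a linear problem in the
     squares. *)
  clearbody u a1 a2 a3 a4 d1 d2 d3 d4 m1 m2 m3.
  move=> [[[[[[[[[? ?] ?] ?] ?] ?] ?] ?] ?] [[? ?] ?]].
  by split; [|split|split|split]; apply: sq0; lra.
(* From u = 0 and the a_j the apex edges vanish. The three matching sums are equal with total 0, so
   opposite base edges are negatives of each other; the zero vertex sums then kill each base
   edge. *)
rewrite /a1 /a2 /a3 /a4 /d1 /d2 /d3 /d4 /m1 /m2 /m3 => -> [? ? ? ?] [? ? ? ?] [? ? ?].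
case=> [[|[|[|[|[|//]]]]] i] [[|[|[|[|[|//]]]]] j] //= _;
  rewrite (bool_irrelevance i isT) (bool_irrelevance j isT); lra.
Qed.

(** Test [T] against its image under J, which is again traceless: the sum of squares must vanish. *)
Lemma hess_gA_nondegenerate k T : 0 < k -> TT (k *: gA R) T ->
  (forall S, TT (k *: gA R) S -> hess (k *: gA R) T S = 0) -> T = 0.
Proof.
move=> k_gt0 /(TT_gA _ k_gt0); set x := k *: _ => TT_T T_perp.
have x_gt0 : inv_metric x by move=> p; rewrite ffunE mulr_gt0 ?gA_gt0.
have tC := symC (log_dir x T).
apply: (log_dir_eq0 x_gt0); apply: hess_form_flip_eq0 => //.
have FC a b := flip_tensorC a b tC.
have TT_F : TT x (of_log_dir x (flip_tensor (sym (log_dir x T)))).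
  apply/TT_gA => //; rewrite /sum_edges !(sym_of_log_dir x_gt0 FC) //.
  exact: sum_edges_flip.
have /eqP := T_perp _ TT_F; rewrite hess_gA // hess_form_log_dir //.
by rewrite mulf_eq0 invr_eq0 gt_eqF //= => /eqP.
Qed.

End Five.

(** Rank-nullity on [U], which meets the kernel of [f] trivially. *)
Lemma dimv_le_inj_rV (F : fieldType) (V : vectType F) (m : nat) (f : V -> 'rV[F]_m)
    (U : {vspace V}) :
  linear f -> (forall w, w \in U -> f w = 0 -> w = 0) -> (\dim U <= m)%N.
Proof.
move=> f_lin f_inj.
pose fL : {linear V -> 'rV[F]_m} :=
  HB.pack f (GRing.isLinear.Build F V 'rV[F]_m *:%R f f_lin).
have capE : (U :&: lker (linfun fL))%VS = 0%VS.
  apply/eqP; rewrite -subv0; apply/subvP => w /memv_capP[wU].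
  by rewrite memv_ker lfunE memv0 => /eqP /(f_inj _ wU) ->.
rewrite -(limg_ker_dim (linfun fL) U) capE dimv0 add0n.
apply: leq_trans (dimvS (subvf _)) _; by rewrite dimvf /dim /= mul1n.
Qed.

(** * The unit-volume rescaling of [gA] and its coindex *)

Section Coindex.
Variable R : realType.
Implicit Types (T S : inv_tensor R 5) (k : R).

Lemma scale_gA_gt0 k : 0 < k -> inv_metric (k *: gA R).
Proof. by move=> k_gt0 p; rewrite ffunE mulr_gt0 ?gA_gt0. Qed.

Lemma gA_einstein : einstein (gA R).
Proof. exact: (einstein_criterion (@gA_gt0 R) (@ricci_gA R)). Qed.

Lemma gA_stability (v : R) : 0 < v ->
  exists2 k, 0 < k & stability_data v (gA R) (k *: gA R) (hess (k *: gA R)).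
Proof.
move=> v_gt0; have [|k k_gt0 kM1] := unit_volume_scaling _ v_gt0 (@gA_gt0 R).
  by apply/card_gt0P; exists (exist _ (o0, o1) isT).
have ricE a b : b != a -> ricci_coef (k *: gA R) a b = k^-1 * (11 / 40).
  by move=> ba; rewrite ricci_coefZ ?gt_eqF // ricci_gA.
have k_metric := scale_gA_gt0 k_gt0.
exists k => //; split=> //; first by exists k.
  exact: einstein_criterion ricE.
exact: hess_is_hessian ricE.
Qed.

Definition star (t : 'I_5 -> R) (a b : 'I_5) : R :=
  if a == o0 then t b else if b == o0 then t a else 0.

Lemma starC t a b : star t a b = star t b a.
Proof.
by rewrite /star; case: (eqVneq a o0) => [->|_]; case: (eqVneq b o0) => [eb|_]; rewrite ?eb.
Qed.

(** For j = 1, 2, 3 the vectors e_j - e_4 form a basis of the standard component of s. *)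
Definition star_tensor k (j : 'I_5) : inv_tensor R 5 :=
  of_log_dir (k *: gA R) (star (fun a => (a == j)%:R - (a == o4)%:R)).

Definition star_tensors k : 3.-tuple (inv_tensor R 5) :=
  [tuple star_tensor k o1; star_tensor k o2; star_tensor k o3].

(** The entries on the first three apex edges give freeness, the fourth one makes the total zero,
    and the zero base edges give positivity. *)
Lemma sym_star_comb k (c : 'I_3 -> R) a b : 0 < k -> a != b ->
  sym (log_dir (k *: gA R) (\sum_(i < 3) c i *: (star_tensors k)`_i)) a b =
  star (fun j => if j == o4 then - (c 0 + c 1 + c 2) else
     if j == o1 then c 0 else if j == o2 then c 1 else if j == o3 then c 2 else 0) a b.
Proof.
move=> k_gt0 ab; have x_gt0 := scale_gA_gt0 k_gt0.
rewrite !big_ord_recl big_ord0 /= !sym_log_dirZ.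
rewrite !(sym_of_log_dir x_gt0 (starC _)) //.
have -> : sym (log_dir (k *: gA R) 0) a b = 0.
  by rewrite /sym big1 // => p _; rewrite !ffunE mul0r.
have -> : lift ord0 (lift ord0 ord0) = 2 :> 'I_3 by apply: val_inj.
have -> : lift ord0 ord0 = 1 :> 'I_3 by apply: val_inj.
have comb j : c 0 * ((j == o1)%:R - (j == o4)%:R) +
    (c 1 * ((j == o2)%:R - (j == o4)%:R) +
    (c 2 * ((j == o3)%:R - (j == o4)%:R) + 0)) =
    if j == o4 then - (c 0 + c 1 + c 2) else
    if j == o1 then c 0 else if j == o2 then c 1 else if j == o3 then c 2 else 0.
  by case: j => [[|[|[|[|[|//]]]]] ?] /=; ring.
rewrite /star; case: ifP => _; first exact: comb.
by case: ifP => _; [exact: comb | ring].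
Qed.

Lemma star_tensors_free k : 0 < k -> free (star_tensors k).
Proof.
move=> k_gt0; apply/freeP => c c0.
have sE a b : a != b -> _ := fun ab => sym_star_comb c k_gt0 ab.
rewrite c0 in sE; have s0 a b : sym (log_dir (k *: gA R) 0) a b = 0.
  by rewrite /sym big1 // => p _; rewrite !ffunE mul0r.
move: (sE o0 o1 isT) (sE o0 o2 isT) (sE o0 o3 isT); rewrite !s0 /star /=.
move=> e1 e2 e3 [[|[|[|//]]] i]; [rewrite [RHS]e1|rewrite [RHS]e2|rewrite [RHS]e3];
  congr c; exact: val_inj.
Qed.

(** Here t = 0, so tracelessness forces \sum s = 0 and J fixes tau: H(tau, tau) is the sum of
    squares itself, which vanishes only at 0. *)
Lemma hess_gA_pos k T : 0 < k -> TT (k *: gA R) T -> T != 0 ->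
  (forall a b : 'I_5, (0 < a < b)%N -> sym (log_dir (k *: gA R) T) a b = 0) ->
  0 < hess (k *: gA R) T T.
Proof.
move=> k_gt0 TT_T T_neq0 T0; have x_gt0 := scale_gA_gt0 k_gt0.
have tC := symC (log_dir (k *: gA R) T).
move/(TT_gA _ k_gt0) : TT_T T0; rewrite hess_gA //.
have := @log_dir_eq0 R _ T x_gt0.
move: (sym _) tC => t tC T_eq0 t0 tI0.
have flipE : hess_form t t = hess_form t (flip_tensor t).
  move: t0; rewrite /sum_edges /hess_form /flip_tensor /=.
  rewrite !(tC o1 o0, tC o2 o0, tC o3 o0, tC o4 o0, tC o2 o1, tC o3 o1, tC o4 o1,
    tC o3 o2, tC o4 o2, tC o4 o3) !(tI0 o1 o2, tI0 o1 o3, tI0 o1 o4, tI0 o2 o3,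
    tI0 o2 o4, tI0 o3 o4) // !addr0 => ->.
  by rewrite mul0r !subr0; ring.
rewrite mulr_gt0 ?invr_gt0 // flipE lt_neqAle hess_form_flip_ge0 // andbT.
apply/eqP => /esym e; move/eqP: T_neq0; apply; apply: T_eq0.
exact: hess_form_flip_eq0.
Qed.

(** For constant s the standard component of s is zero, so J tau = -tau and H(tau, tau) is minus the
    sum of squares. *)
Lemma hess_gA_le0 k T : 0 < k -> TT (k *: gA R) T ->
  (forall a : 'I_5, (0 < a)%N -> sym (log_dir (k *: gA R) T) o0 a =
                               sym (log_dir (k *: gA R) T) o0 o4) ->
  hess (k *: gA R) T T <= 0.
Proof.
move=> k_gt0 TT_T T0; have tC := symC (log_dir (k *: gA R) T).
move/(TT_gA _ k_gt0) : TT_T T0; rewrite hess_gA //.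
move: (sym _) tC => t tC t0 tE.
have flipE : hess_form t t = - hess_form t (flip_tensor t).
  rewrite /hess_form /flip_tensor /=.
  rewrite !(tC o1 o0, tC o2 o0, tC o3 o0, tC o4 o0, tC o2 o1, tC o3 o1, tC o4 o1,
    tC o3 o2, tC o4 o2, tC o4 o3) (tE o1) // (tE o2) // (tE o3) //.
  by field.
rewrite flipE mulrN oppr_le0; apply: mulr_ge0; first by rewrite invr_ge0 ltW.
exact: hess_form_flip_ge0.
Qed.

(** The three differences s_j - s_4 are injective on a positive subspace: where they all vanish, s
    is constant and H is non-positive. *)
Lemma gA_coindex_le k U : 0 < k ->
  positive_subspace (k *: gA R) (hess (k *: gA R)) U -> (\dim U <= 3)%N.
Proof.
move=> k_gt0 U_pos; pose t T := sym (log_dir (k *: gA R) T).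
apply: (@dimv_le_inj_rV _ _ 3 (fun T =>
  (* The composite of [widen_ord] and [lift ord0] sends the column j to the vertex j + 1. *)
  \row_(j < 3) (t T o0 (lift ord0 (widen_ord (leqnSn 3) j)) - t T o0 o4))).
  move=> c T S; apply/rowP => j; rewrite !mxE /t !sym_log_dirZ; ring.
move=> T TU /rowP T_ker; have [TT_T T_pos] := U_pos _ TU.
apply/eqP; apply/negPn/negP => /T_pos; apply/negP; rewrite -leNgt.
apply: hess_gA_le0 => // a a0; apply/eqP; rewrite -subr_eq0; apply/eqP.
move: a0; case: a => [[|[|[|[|[|//]]]]] i] //= _.
- by have := T_ker ord0; rewrite !mxE => <-; congr (t T _ _ - _); apply: val_inj.
- by have := T_ker (@Ordinal 3 1 isT); rewrite !mxE => <-; congr (t T _ _ - _); apply: val_inj.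
- by have := T_ker (@Ordinal 3 2 isT); rewrite !mxE => <-; congr (t T _ _ - _); apply: val_inj.
- by rewrite (bool_irrelevance i isT) subrr.
Qed.

Lemma star_tensors_pos k : 0 < k ->
  positive_subspace (k *: gA R) (hess (k *: gA R)) <<star_tensors k>>%VS.
Proof.
move=> k_gt0 T TU; pose c i := coord (star_tensors k) i T.
have : T = \sum_i c i *: (star_tensors k)`_i := coord_span TU.
move: {TU} c => c ->.
have sE a b : a != b -> _ := fun ab => sym_star_comb c k_gt0 ab.
have TT_T : TT (k *: gA R) (\sum_i c i *: (star_tensors k)`_i).
  by apply/TT_gA; rewrite // /sum_edges !sE // /star /=; ring.
split=> // T_neq0; apply: hess_gA_pos => // a b /andP[a0 ab].
rewrite sE; last by rewrite -val_eqE /=; lia.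
by rewrite /star -!val_eqE /=; do 2 (case: eqP => ?; first lia).
Qed.

End Coindex.

Theorem proposition8p3 (R : realType) (v : R) (hv : 0 < v) :
  [/\ einstein (gA R),
      G_nondegenerate v (gA R),
      G_unstable v (gA R) &
      has_coindex v (gA R) 3].
Proof.
have [k k_gt0 stab] := gA_stability hv.
have dimU : \dim <<star_tensors k>> = 3.
  by rewrite (eqP (star_tensors_free k_gt0)) size_tuple.
have U_pos := star_tensors_pos k_gt0.
split; first exact: gA_einstein.
- exists (k *: gA R), (hess (k *: gA R)); split=> // T TT_T T_perp.
  exact: hess_gA_nondegenerate T_perp.
- exists (k *: gA R), (hess (k *: gA R)); split=> //.
  (* Any nonzero vector of the 3-dimensional positive subspace is a destabilizing direction. *)
  have U0 : <<star_tensors k>>%VS != 0%VS by rewrite -dimv_eq0 dimU.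
  have [TT_T T_pos] := U_pos _ (memv_pick _).
  by exists (vpick <<star_tensors k>>) => //; apply: T_pos; rewrite vpick0.
exists (k *: gA R), (hess (k *: gA R)); split=> //; last by move=> U; exact: gA_coindex_le.
by exists <<star_tensors k>>%VS.
Qed.
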